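(* Fix $r>0$ and let $n(r)$ be the number of zeroes of the planar Gaussian analytic function $\mathbf{g}$ in the disk of radius $r$ around $0$. For any $\epsilon>0$ there exists a constant $C_2$ (depending on $\epsilon$ and $r$) such that for every integer $m\ge 1$, $$e^{-\frac{1}{2}m^2\log(m)+O(m^2)}\le \mathbf{P}[n(r)\ge m]\le C_2\,e^{-\left(\frac12-\epsilon\right)m^2\log(m)},$$ where the constant implied in $O(m^2)$ may depend on $r$ but not on $m$. In particular, $\mathbf{P}[n(r)\ge m]=e^{-\frac12 m^2\log(m)(1+o(1))}$ as $m\to\infty$.
   Context: A standard complex normal random variable has density $\frac1\pi e^{-|z|^2}$ on $\mathbb{C}$. The planar Gaussian analytic function is the random entire function $\mathbf{g}(z)=\sum_{n=0}^{\infty}\frac{a_n z^n}{\sqrt{n!}}$, where $a_n$, $n\ge 0$, are i.i.d. standard complex normal random variables. *)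

(* Defs.v *)
From HB Require Import structures.
From mathcomp Require Import all_boot all_order all_algebra.
From mathcomp Require Import all_classical all_reals all_analysis.
From mathcomp.real_closed Require Import complex.

Set Implicit Arguments.
Unset Strict Implicit.
Unset Printing Implicit Defensive.

Import Order.TTheory GRing.Theory Num.Theory.
Import numFieldNormedType.Exports.

Local Open Scope classical_set_scope.
Local Open Scope ring_scope.
Local Open Scope complex_scope.

(* Bundling [R[i]] as a [numClosedFieldType] is what gives access to the
   topology and normed module structure that the library attaches to abstract
   number fields; these are not inferred on the bare type [R[i]]. *)
Definition Cplx (R : realType) : numClosedFieldType := R[i].

Section random_coefficients.
Context {R : realType} {d : measure_display} {T : measurableType d}.
Variable P : probability T R.

(* [R[i]] carries no sigma-algebra in the library: it is identified with the
   plane and given the Borel sets of the product. *)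
Definition plane_of (z : Cplx R) : measurableTypeR R * measurableTypeR R :=
  (complex.Re z, complex.Im z).

Definition std_complex_normal (X : T -> Cplx R) : Prop :=
  measurable_fun [set: T] (plane_of \o X) /\
  forall A : set (measurableTypeR R * measurableTypeR R), measurable A ->
    P ((plane_of \o X) @^-1` A) =
    (\int[lebesgue_measure \x lebesgue_measure]_(p in A)
       (pi^-1 * expR (- (p.1 ^+ 2 + p.2 ^+ 2)))%:E)%E.

Definition mutually_independent (X : nat -> T -> Cplx R) : Prop :=
  forall (J : seq nat) (B : nat -> set (measurableTypeR R * measurableTypeR R)),
    uniq J -> (forall j, measurable (B j)) ->
    P (\bigcap_(j in [set` J]) (plane_of \o X j) @^-1` B j) =
    (\prod_(j <- J) P ((plane_of \o X j) @^-1` B j))%E.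

Definition iid_std_complex_normal (X : nat -> T -> Cplx R) : Prop :=
  (forall n, std_complex_normal (X n)) /\ mutually_independent X.

End random_coefficients.

Section planar_gaf.
Context {R : realType}.

Definition gaf_partial_sums (c : nat -> Cplx R) (z : Cplx R) : (Cplx R) ^nat :=
  series (fun n => c n * z ^+ n / (Num.sqrt (n`!%:R : R))%:C).

(* For i.i.d. standard complex normal coefficients the series converges on the
   whole plane almost surely. On the exceptional null event the value is the
   zero function, so that every sample function is entire. *)
Definition planar_gaf (T : Type) (a : nat -> T -> Cplx R) (w : T) :
    Cplx R -> Cplx R :=
  if `[< forall z, cvgn (gaf_partial_sums (a ^~ w) z) >]
  then fun z => limn (gaf_partial_sums (a ^~ w) z)
  else fun=> 0.

(* The order of vanishing of an entire [f] at [z]: [0] when [f z != 0], and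
   [+oo] when [f] is identically zero. The derivatives are complex ones. *)
Definition zero_multiplicity (f : Cplx R -> Cplx R) (z : Cplx R) : \bar R :=
  ereal_sup [set (k%:R)%:E | k in
    [set k : nat | forall j : nat, (j < k)%N -> derive1n j f z = 0]].

(* Zeros are counted with multiplicity, in the open disk. *)
Definition num_zeros (f : Cplx R -> Cplx R) (r : R) : \bar R :=
  \esum_(z in [set z : Cplx R | `|z| < r%:C]) zero_multiplicity f z.

End planar_gaf.

(* Main.v *)
Require Import Defs.
From HB Require Import structures.
From mathcomp Require Import all_boot all_order all_algebra.
From mathcomp Require Import all_classical all_reals all_analysis.
From mathcomp Require Import measurable_realfun.
From mathcomp Require Import ring lra.
From mathcomp.real_closed Require Import complex.

(** Write the Gaussian analytic function as [sum_n c_n z^n], where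
    [c_n = a_n / sqrt n!]. Having [m] zeros in the disk of radius [r] is
    compared, from both sides, with events that constrain the moduli of the
    coefficients one at a time; independence then gives the probability as a
    product of probabilities for a single Gaussian. The comparison is algebra
    of power series, with no contour integral: if [w] is a zero, then
    [c = (X - w) d] with [d_n = sum_k c_(n+1+k) w^k] ([div_linear]), and a bound
    [|c_n| s^n <= A] passes to [d] with [A] replaced by [A / (s - |w|)]. As the
    multiplicities at all points are those of [d], plus one at [w],
    having at least [m] zeros means that this division can be performed [m]
    times at points of the disk ([num_zerosP]).

    Upper bound. Dividing by [m] zeros gains a factor [(s - r)^(-m)], while the
    [m] linear factors have coefficients at most exponential in [m], so
    each of [c_0, ..., c_(m-1)] is at most [A L^m (s - r)^(-m)]
    ([has_zeros_coef_le]). Take [s = r + sqrt m]: outside an event of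
    doubly exponentially small probability [A] is [e^(O(m))], hence
    [|a_k| <= sqrt (k!) L^m m^(-m/2)] for all [k < m]. Since
    [P(|a_k| <= x) <= 2 x^2], the probability is at most
    [e^(O(m^2)) m^(-m^2) prod_(k < m) k!], and
    [(prod_(k < m) k!)^2 <= m^(m^2)] by pairing [k] with [m - 1 - k].

    Lower bound. If [|a_m| >= K], [|a_n| <= 2^(n-m+1)] for [n > m] and
    [|a_n| <= rho^m m^(-(m-n)/2)] for [n < m], then the term of degree [m]
    dominates all the others on the circle of radius [r], and there are at
    least [m] zeros inside ([dominant_has_zeros]). This instance of Rouche's
    theorem is obtained from Weierstrass preparation: a Neumann series yields a
    power series [g] close to [1] such that [c g] is a monic polynomial of
    degree [m]; its roots are small, and [g] does not vanish at them. The
    constraints with [n >= m] have probability bounded below uniformly in [m];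
    the others contribute
    [prod_(n < m) e^(-O(m)) m^(-(m-n)) = e^(-O(m^2)) m^(-m(m+1)/2)].

    Measurability. Having [m] zeros in some closed smaller disk is detected by
    approximate zeros with rational coordinates, because exact zeros are
    recovered as limits along an ultrafilter ([has_zeros_approx]).

    Both bounds have an error [e^(O(m^2))], from which the last two claims are
    read off, [m^2] being negligible compared with [m^2 log m]. *)

Import Order.TTheory GRing.Theory Num.Theory.
Import numFieldNormedType.Exports.

Local Open Scope classical_set_scope.
Local Open Scope ring_scope.

Set Implicit Arguments.
Unset Strict Implicit.
Unset Printing Implicit Defensive.

(** * The modulus as a real number, and limits of complex-valued functions *)
Section complex_norm.
Context {R : realType}.
Implicit Types (z w : Cplx R) (x : R).

(** The canonical norm of [Cplx R] is itself a complex number, whose order is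
    only partial; estimates are carried out with this real-valued version. *)
Definition nrm (z : Cplx R) : R := Normc.normc z.

Definition real_cplx (x : R) : Cplx R := Complex x 0.

Lemma normE z : `|z| = real_cplx (nrm z).
Proof. by []. Qed.

Lemma nrm_ge0 z : 0 <= nrm z.
Proof. by case: z => a b; rewrite /nrm /= sqrtr_ge0. Qed.

Lemma nrm0 : nrm 0 = 0. Proof. exact: Normc.normc0. Qed.

Lemma nrm1 : nrm 1 = 1. Proof. exact: Normc.normc1. Qed.

Lemma nrm_eq0 z : (nrm z == 0) = (z == 0).
Proof.
by apply/eqP/eqP => [/Normc.eq0_normc//|->]; exact: nrm0.
Qed.

Lemma nrmM z w : nrm (z * w) = nrm z * nrm w.
Proof. exact: Normc.normcM. Qed.

Lemma nrmV z : nrm z^-1 = (nrm z)^-1.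
Proof. exact: Normc.normcV. Qed.

Lemma nrmD z w : nrm (z + w) <= nrm z + nrm w.
Proof.
have := ler_normD z w; rewrite !normE /real_cplx.
by rewrite lecE /= => /andP[_].
Qed.

Lemma nrmN z : nrm (- z) = nrm z.
Proof. by case: z => a b; rewrite /nrm /= !sqrrN. Qed.

Lemma nrmB z w : nrm (z - w) <= nrm z + nrm w.
Proof. by rewrite (le_trans (nrmD _ _))// nrmN. Qed.

Lemma nrm_distC z w : nrm (z - w) = nrm (w - z).
Proof. by rewrite -nrmN opprB. Qed.

Lemma nrm_distD v z w : nrm (z - w) <= nrm (z - v) + nrm (v - w).
Proof. by rewrite (le_trans _ (nrmD _ _))// addrA subrK. Qed.

Lemma nrmX z n : nrm (z ^+ n) = nrm z ^+ n.
Proof. by elim: n => [|n IH]; rewrite ?expr0 ?nrm1// !exprS nrmM IH. Qed.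

Lemma nrm_real x : nrm (real_cplx x) = `|x|.
Proof. by rewrite /nrm /= expr0n addr0 sqrtr_sqr. Qed.

Lemma nrm_nat n : nrm n%:R = n%:R.
Proof.
have -> : (n%:R : Cplx R) = real_cplx n%:R.
  by rewrite -[RHS]/(real_complex R n%:R) rmorph_nat.
by rewrite nrm_real ger0_norm.
Qed.

Lemma nrm_sum (I : Type) (r : seq I) (p : pred I) (F : I -> Cplx R) :
  nrm (\sum_(i <- r | p i) F i) <= \sum_(i <- r | p i) nrm (F i).
Proof.
elim/big_ind2 : _ => //; first by rewrite nrm0.
by move=> z1 x1 z2 x2 h1 h2; rewrite (le_trans (nrmD _ _))// lerD.
Qed.

Lemma ReB z w : complex.Re (z - w) = complex.Re z - complex.Re w.
Proof. by case: z w => ? ? [? ?]. Qed.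

Lemma ImB z w : complex.Im (z - w) = complex.Im z - complex.Im w.
Proof. by case: z w => ? ? [? ?]. Qed.

Lemma ReD z w : complex.Re (z + w) = complex.Re z + complex.Re w.
Proof. by case: z w => ? ? [? ?]. Qed.

Lemma ImD z w : complex.Im (z + w) = complex.Im z + complex.Im w.
Proof. by case: z w => ? ? [? ?]. Qed.

Lemma Re_nrm z : `|complex.Re z| <= nrm z.
Proof.
case: z => a b; rewrite /nrm /= -sqrtr_sqr ler_wsqrtr// lerDl sqr_ge0//.
Qed.

Lemma Im_nrm z : `|complex.Im z| <= nrm z.
Proof.
case: z => a b; rewrite /nrm /= -sqrtr_sqr ler_wsqrtr// lerDr sqr_ge0//.
Qed.

Lemma nrm_ReIm z : nrm z <= `|complex.Re z| + `|complex.Im z|.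
Proof.
case: z => a b /=; rewrite /nrm /= -[leRHS]ger0_norm ?addr_ge0//.
rewrite -sqrtr_sqr ler_wsqrtr// sqrrD !real_normK ?num_real//.
by rewrite -addrA [X in _ <= _ + X]addrC addrA lerDl mulrn_wge0// mulr_ge0.
Qed.

(** Bridge from the norm topology of [Cplx R] to limits of real numbers, where
    squeezing is available. *)
Lemma cvg_nrm (T : Type) (F : set_system T) {FF : Filter F}
    (u : T -> Cplx R) (l : Cplx R) :
  u @ F --> l <-> (fun t => nrm (u t - l)) @ F --> (0 : R).
Proof.
split=> [/cvgrPdist_lt ul|/cvgrPdist_lt ul].
  apply/cvgrPdist_lt => e e0.
  have e0' : 0 < real_cplx e by rewrite /real_cplx ltcE /= eqxx.
  apply: filterS (ul _ e0') => t; rewrite normE ltcE /= => /andP[_].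
  by rewrite sub0r normrN ger0_norm ?nrm_ge0// nrm_distC.
apply/cvgrPdist_lt => -[e e']; rewrite ltcE /= => /andP[/eqP -> e0].
apply: filterS (ul _ e0) => t; rewrite sub0r normrN ger0_norm ?nrm_ge0//.
by rewrite normE ltcE /= eqxx nrm_distC.
Qed.

Lemma cvg_squeeze0 (T : Type) (F : set_system T) {FF : Filter F}
    (u v : T -> R) :
  (forall t, 0 <= u t <= v t) -> v @ F --> (0 : R) -> u @ F --> (0 : R).
Proof.
move=> uv; apply: (squeeze_cvgr (f := fun=> 0)); last exact: cvg_cst.
exact: nearW.
Qed.

Lemma cvg_ReIm (T : Type) (F : set_system T) {FF : Filter F}
    (u : T -> Cplx R) (l : Cplx R) :
  u @ F --> l <->
  (fun t => complex.Re (u t)) @ F --> complex.Re l /\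
  (fun t => complex.Im (u t)) @ F --> complex.Im l.
Proof.
split=> [/cvg_nrm ul|[ul vl]].
  split; apply/subr_cvg0; apply/(@norm_cvg0P _ R^o); apply: cvg_squeeze0 ul => t.
    by rewrite normr_ge0 /= -ReB Re_nrm.
  by rewrite normr_ge0 /= -ImB Im_nrm.
apply/cvg_nrm.
have {}ul : (fun t => `|complex.Re (u t) - complex.Re l|) @ F --> (0 : R).
  by apply/(@norm_cvg0P _ R^o)/subr_cvg0.
have {}vl : (fun t => `|complex.Im (u t) - complex.Im l|) @ F --> (0 : R).
  by apply/(@norm_cvg0P _ R^o)/subr_cvg0.
have := cvgD ul vl; rewrite addr0 => uvl; apply: (cvg_squeeze0 _ (uvl FF)) => t.
by rewrite nrm_ge0 /= (le_trans (nrm_ReIm _))// ReB ImB.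
Qed.

Lemma cvg_nrm_le (F : set_system nat) {FF : ProperFilter F}
    (u : nat -> Cplx R) (l : Cplx R) (b : R) :
  u @ F --> l -> (forall n, nrm (u n) <= b) -> nrm l <= b.
Proof.
move=> /cvg_nrm ul ub; rewrite -subr_le0.
apply: (ler_cvg_to (cvg_cst (nrm l - b)) ul); apply: nearW => n; rewrite lerBlDr.
have := nrm_distD (u n) l 0; rewrite !subr0 nrm_distC => /le_trans; apply.
by rewrite lerD2l.
Qed.

End complex_norm.

(** * Coefficient sequences: values, growth bounds, division by [X - w] *)
Section power_series.
Context {R : realType}.
Implicit Types (c d : nat -> Cplx R) (z w : Cplx R) (s t A B : R).

Definition ps_val c w : Cplx R := limn (series (fun n => c n * w ^+ n)).

Definition ps_cvg c w := cvgn (series (fun n => c n * w ^+ n)).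

(** A weighted supremum norm: the series converges on the open disk of radius
    [s], with explicit bounds. *)
Definition coef_bd s A c := forall n, nrm (c n) * s ^+ n <= A.

(** Values of tails satisfy the Horner recursion
    [ps_val (ps_tail c n) w = c n + w * ps_val (ps_tail c n.+1) w]; this
    recursion is what makes division by [X - w] work. *)
Definition ps_tail c k n := c (k + n)%N.

Definition ps_const (v : Cplx R) (n : nat) : Cplx R := if n == 0%N then v else 0.

(** The coefficients of [(X - w) * c]. *)
Definition mul_linear w c n : Cplx R := (if n is k.+1 then c k else 0) - w * c n.

(** The coefficients of [(c(X) - c(w)) / (X - w)]. *)
Definition div_linear c w n := ps_val (ps_tail c n.+1) w.

Lemma ps_val_eq c w l : series (fun n => c n * w ^+ n) @ \oo --> l -> ps_val c w = l.
Proof. by move=> h; apply: cvg_lim h; exact: norm_hausdorff. Qed.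

Lemma coef_bd_ge0 s A c : coef_bd s A c -> 0 <= A.
Proof. by move/(_ 0%N); rewrite expr0 mulr1; apply: le_trans; exact: nrm_ge0. Qed.

Lemma sum_geometric_le s t A n : 0 <= A -> 0 < s -> 0 <= t < s ->
  \sum_(0 <= k < n) A * (t / s) ^+ k <= A * s / (s - t).
Proof.
move=> A0 s0 /andP[t0 ts]; rewrite -mulr_sumr -mulrA ler_wpM2l//.
have st : 0 < s - t by rewrite subr_gt0.
rewrite ler_pdivlMr//.
have q0 : 0 <= t / s by rewrite divr_ge0// ltW.
have /(congr1 ( *%R^~ (- s))) := subrX1 (t / s) n.
rewrite big_mkord mulrAC.
have -> : (t / s - 1) * - s = s - t by field; rewrite gt_eqF.
rewrite [leLHS]mulrC => <-.
by rewrite mulrN mulrBl mul1r opprB gerBl mulr_ge0 ?exprn_ge0 ?(ltW s0).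
Qed.

Lemma coef_bd_term s t A c w n : 0 < s -> coef_bd s A c -> nrm w <= t ->
  nrm (c n * w ^+ n) <= A * (t / s) ^+ n.
Proof.
move=> s0 cA wt; rewrite nrmM nrmX.
have t0 : 0 <= t by rewrite (le_trans _ wt)// nrm_ge0.
rewrite expr_div_n mulrA ler_pdivlMr ?exprn_gt0// mulrAC.
apply: ler_pM; rewrite ?mulr_ge0 ?nrm_ge0 ?exprn_ge0 ?nrm_ge0 ?(ltW s0)//.
by rewrite lerXn2r ?nnegrE ?nrm_ge0.
Qed.

(** Comparison with a geometric series, applied to the real and imaginary
    parts: completeness is used for real series only. *)
Lemma coef_bd_cvg s A c w : 0 < s -> coef_bd s A c -> nrm w < s -> ps_cvg c w.
Proof.
move=> s0 cA ws; set u := fun n => c n * w ^+ n.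
have gcv : cvgn (series (geometric A (nrm w / s))).
  apply: is_cvg_geometric_series.
  by rewrite ger0_norm ?divr_ge0 ?nrm_ge0 ?(ltW s0)// ltr_pdivrMr// mul1r.
have ubd n : nrm (u n) <= geometric A (nrm w / s) n by exact: coef_bd_term.
have cvR (f : Cplx R -> R) : (forall z, `|f z| <= nrm z) ->
    cvgn (series (f \o u)).
  move=> fz; apply: normed_cvg; apply: series_le_cvg gcv.
  - by move=> n /=.
  - move=> n; rewrite /geometric /= mulr_ge0 ?(coef_bd_ge0 cA)//.
    by rewrite exprn_ge0 ?divr_ge0 ?nrm_ge0 ?ltW.
  - by move=> n /=; rewrite (le_trans (fz _)).
have /cvg_ex[/= a ha] := cvR (@complex.Re R) (@Re_nrm R).
have /cvg_ex[/= b hb] := cvR (@complex.Im R) (@Im_nrm R).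
have sRe n : complex.Re (series u n) = series (@complex.Re R \o u) n.
  rewrite !seriesEnat /=; elim/big_ind2 : _ => //= x1 y1 x2 y2 <- <-.
  by rewrite ReD.
have sIm n : complex.Im (series u n) = series (@complex.Im R \o u) n.
  rewrite !seriesEnat /=; elim/big_ind2 : _ => //= x1 y1 x2 y2 <- <-.
  by rewrite ImD.
apply/cvg_ex; exists (Complex a b : Cplx R); apply/cvg_ReIm; split => /=.
  by under eq_fun do rewrite sRe.
by under eq_fun do rewrite sIm.
Qed.

Lemma ps_val_le s t A c w : 0 < s -> coef_bd s A c -> nrm w <= t -> t < s ->
  nrm (ps_val c w) <= A * s / (s - t).
Proof.
move=> s0 cA wt ts.
have t0 : 0 <= t by rewrite (le_trans _ wt)// nrm_ge0.
apply: (cvg_nrm_le (coef_bd_cvg s0 cA (le_lt_trans wt ts))) => n.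
rewrite seriesEnat (le_trans (nrm_sum _ _ _))//.
rewrite (le_trans _ (@sum_geometric_le s t A n _ _ _)) ?(coef_bd_ge0 cA) ?t0//.
by apply: ler_sum => k _; exact: coef_bd_term.
Qed.

Lemma ps_cvgD c d w : ps_cvg c w -> ps_cvg d w -> ps_cvg (fun n => c n + d n) w /\
  ps_val (fun n => c n + d n) w = ps_val c w + ps_val d w.
Proof.
move=> hc hd.
have h : series (fun n => (c n + d n) * w ^+ n) @ \oo --> ps_val c w + ps_val d w.
  have -> : series (fun n => (c n + d n) * w ^+ n) = fun n =>
      series (fun n => c n * w ^+ n) n + series (fun n => d n * w ^+ n) n.
    apply/funext => n; rewrite !seriesEnat /= -big_split.
    by apply: eq_bigr => i _; rewrite mulrDl.
  exact: (cvgD hc hd).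
by split; [exact: cvgP h|exact: ps_val_eq].
Qed.

Lemma ps_cvgZ a c w : ps_cvg c w -> ps_cvg (fun n => a * c n) w /\
  ps_val (fun n => a * c n) w = a * ps_val c w.
Proof.
move=> hc.
have h : series (fun n => (a * c n) * w ^+ n) @ \oo --> a * ps_val c w.
  have -> : series (fun n => (a * c n) * w ^+ n) =
      fun n => a * series (fun n => c n * w ^+ n) n.
    apply/funext => n; rewrite !seriesEnat /= big_distrr.
    by apply: eq_bigr => i _; rewrite /= mulrA.
  exact: (cvgM (cvg_cst a) hc).
by split; [exact: cvgP h|exact: ps_val_eq].
Qed.

Lemma ps_cvg_recl c w : ps_cvg (ps_tail c 1) w ->
  ps_cvg c w /\ ps_val c w = c 0%N + w * ps_val (ps_tail c 1) w.
Proof.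
move=> hc.
have h : series (fun n => c n * w ^+ n) @ \oo --> c 0%N + w * ps_val (ps_tail c 1) w.
  rewrite -(cvg_shiftn 1).
  rewrite (_ : [sequence _]_n = fun n =>
      c 0%N + w * series (fun n => ps_tail c 1 n * w ^+ n) n).
    exact: (cvgD (cvg_cst (c 0%N)) (cvgM (cvg_cst w) hc)).
  apply/funext => n /=; rewrite !seriesEnat /= addn1 big_nat_recl// expr0 mulr1.
  by congr (_ + _); rewrite big_distrr; apply: eq_bigr => i _; rewrite /= exprS mulrCA.
by split; [exact: cvgP h|exact: ps_val_eq].
Qed.

Lemma ps_val0 w : ps_val (fun=> 0) w = 0.
Proof.
apply: ps_val_eq; rewrite [X in X @ _](_ : _ = fun=> 0); first exact: cvg_cst.
by apply/funext => n; rewrite seriesEnat /= big1// => i _; rewrite mul0r.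
Qed.

Lemma ps_cvg0 w : ps_cvg (fun=> 0) w.
Proof.
apply/cvg_ex; exists 0.
rewrite [X in X @ _](_ : _ = fun=> 0); first exact: cvg_cst.
by apply/funext => n; rewrite seriesEnat /= big1// => i _; rewrite mul0r.
Qed.

Lemma ps_cvg_const v w : ps_cvg (ps_const v) w /\ ps_val (ps_const v) w = v.
Proof.
have [h1 ->] := @ps_cvg_recl (ps_const v) w (@ps_cvg0 w); split => //.
by rewrite -[ps_val _ _]/(ps_val (fun=> 0) w) ps_val0 mulr0 addr0.
Qed.

Lemma ps_cvg_mul_linear a c w : ps_cvg c w -> ps_cvg (mul_linear a c) w /\
  ps_val (mul_linear a c) w = (w - a) * ps_val c w.
Proof.
move=> hc; pose sh n := if n is k.+1 then c k else 0.
have [h1 e1] := @ps_cvg_recl sh w hc.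
have [h2 e2] := ps_cvgZ (- a) hc.
have [h3 e3] := ps_cvgD h1 h2.
have -> : mul_linear a c = (fun n => sh n + (- a) * c n).
  by apply/funext => n; rewrite /mul_linear mulNr.
by split => //; rewrite e3 e2 e1 add0r mulNr mulrBl.
Qed.

Lemma coef_bd_tail s A c k : 0 < s -> coef_bd s A c -> coef_bd s (A / s ^+ k) (ps_tail c k).
Proof.
move=> s0 cA n; rewrite ler_pdivlMr ?exprn_gt0//.
by rewrite -mulrA -exprD addnC; exact: cA.
Qed.

(** Dividing keeps the radius [s] and only changes the constant, so that the
    bound can be iterated over any number of zeros. *)
Lemma coef_bd_div_linear s t A c w : 0 < s -> coef_bd s A c -> nrm w <= t -> t < s ->
  coef_bd s (A / (s - t)) (div_linear c w).
Proof.
move=> s0 cA wt ts n.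
rewrite -ler_pdivlMr ?exprn_gt0//.
rewrite (le_trans (ps_val_le s0 (coef_bd_tail n.+1 s0 cA) wt ts))//.
rewrite le_eqVlt; apply/orP; left; apply/eqP.
rewrite exprS; field.
by rewrite ?expf_neq0 ?subr_eq0 ?gt_eqF.
Qed.

Lemma ps_val_tail s A c w n : 0 < s -> coef_bd s A c -> nrm w < s ->
  ps_val (ps_tail c n) w = c n + w * div_linear c w n.
Proof.
move=> s0 cA ws; have tA := coef_bd_tail 1 s0 (coef_bd_tail n s0 cA).
have [_ ->] := ps_cvg_recl (coef_bd_cvg s0 tA ws).
rewrite {1}/ps_tail addn0; congr (_ + _ * ps_val _ _).
by apply/funext => k; rewrite /ps_tail add1n addnS.
Qed.

Lemma div_linearP s A c w : 0 < s -> coef_bd s A c -> nrm w < s ->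
  c = (fun n => ps_const (ps_val c w) n + mul_linear w (div_linear c w) n).
Proof.
move=> s0 cA ws; apply/funext => -[|n]; rewrite /ps_const /mul_linear /=.
  by rewrite sub0r -[ps_val c w]/(ps_val (ps_tail c 0) w) (ps_val_tail _ s0 cA ws) addrK.
by rewrite add0r {1}/div_linear (ps_val_tail _ s0 cA ws) addrK.
Qed.

Lemma div_linear_root s A c w : 0 < s -> coef_bd s A c -> nrm w < s -> ps_val c w = 0 ->
  c = mul_linear w (div_linear c w).
Proof.
move=> s0 cA ws c0; rewrite {1}(div_linearP s0 cA ws) c0; apply/funext => n.
by rewrite /ps_const; case: (n == 0%N); rewrite add0r.
Qed.

(** The difference quotient is again the value of a power series; continuity,
    Lipschitz bounds and the derivative all follow from this identity. *)
Lemma ps_val_sub s A c z w : 0 < s -> coef_bd s A c -> nrm z < s -> nrm w < s ->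
  ps_val c z - ps_val c w = (z - w) * ps_val (div_linear c w) z.
Proof.
move=> s0 cA zs ws; rewrite {1}(div_linearP s0 cA ws).
have [h1 e1] := ps_cvg_const (ps_val c w) z.
have [h2 e2] := ps_cvg_mul_linear w (coef_bd_cvg s0 (coef_bd_div_linear s0 cA (lexx _) ws) zs).
by have [_ ->] := ps_cvgD h1 h2; rewrite e1 e2 addrC addKr.
Qed.

Lemma div_linear_lipschitz s t A c w w' : 0 < s -> coef_bd s A c ->
  nrm w <= t -> nrm w' <= t -> t < s ->
  coef_bd s (A * nrm (w - w') / (s - t) ^+ 2) (fun n => div_linear c w n - div_linear c w' n).
Proof.
move=> s0 cA wt wt' ts n; rewrite /div_linear.
have b1 := coef_bd_tail n.+1 s0 cA.
rewrite (ps_val_sub s0 b1 (le_lt_trans wt ts) (le_lt_trans wt' ts)) nrmM.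
rewrite -ler_pdivlMr ?exprn_gt0//.
have := ps_val_le s0 (coef_bd_div_linear s0 b1 wt' ts) wt ts.
move=> /(ler_wpM2l (nrm_ge0 (w - w'))) /le_trans; apply.
rewrite le_eqVlt; apply/orP; left; apply/eqP.
rewrite exprS; field.
by rewrite ?expf_neq0 ?subr_eq0 ?gt_eqF.
Qed.

Lemma coef_bdD s A B c d : 0 < s -> coef_bd s A c -> coef_bd s B d ->
  coef_bd s (A + B) (fun n => c n + d n).
Proof.
move=> s0 cA dB n; rewrite (le_trans _ (lerD (cA n) (dB n)))//.
by rewrite -mulrDl ler_wpM2r ?exprn_ge0 ?(ltW s0)// nrmD.
Qed.

Lemma ps_val_lipschitz s t A c z w : 0 < s -> coef_bd s A c -> nrm z <= t -> nrm w <= t ->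
  t < s -> nrm (ps_val c z - ps_val c w) <= A * nrm (z - w) * s / (s - t) ^+ 2.
Proof.
move=> s0 cA zt wt ts.
rewrite (ps_val_sub s0 cA (le_lt_trans zt ts) (le_lt_trans wt ts)) nrmM.
have := ps_val_le s0 (coef_bd_div_linear s0 cA wt ts) zt ts.
move=> /(ler_wpM2l (nrm_ge0 (z - w))) /le_trans; apply.
rewrite le_eqVlt; apply/orP; left; apply/eqP; field.
by rewrite subr_eq0 gt_eqF.
Qed.

End power_series.

(** * Multiplicities and the number of zeros through division *)
Section zero_counting.
Context {R : realType}.
Implicit Types (c d : nat -> Cplx R) (z w : Cplx R) (s t A B r : R).

Definition entire c := forall s, 0 < s -> exists A, coef_bd s A c.

Definition formal_deriv c n : Cplx R := n.+1%:R * c n.+1.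

Lemma entireP c t : entire c -> exists s A, [/\ 0 < s, t < s & coef_bd s A c].
Proof.
move=> ce; have s0 : 0 < `|t| + 1 by rewrite ltr_wpDl.
have [A cA] := ce _ s0; exists (`|t| + 1), A; split => //.
by rewrite (le_lt_trans (ler_norm _))// ltrDl.
Qed.

Lemma entire_ps_cvg c z : entire c -> ps_cvg c z.
Proof. by move=> /(entireP (nrm z))[s [A [s0 zs cA]]]; exact: coef_bd_cvg cA zs. Qed.
Arguments entire_ps_cvg {c} z _.

Lemma coef_bd_shrink s t A c : 0 <= t -> t <= s -> coef_bd s A c -> coef_bd t A c.
Proof.
move=> t0 ts cA n; apply: le_trans (cA n).
by rewrite ler_wpM2l ?nrm_ge0// lerXn2r// nnegrE// (le_trans t0).
Qed.

Lemma entire_div_linear c w : entire c -> entire (div_linear c w).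
Proof.
move=> /(entireP _) ce s s0.
have [u [A [u0 su cA]]] := ce (Num.max s (nrm w)).
exists (A / (u - nrm w)); apply: (@coef_bd_shrink u); first exact: ltW.
  by rewrite (le_trans _ (ltW su))// le_max lexx.
apply: coef_bd_div_linear => //; rewrite (le_lt_trans _ su)// le_max lexx orbT//.
Qed.

Lemma entire_div_linear_root c w : entire c -> ps_val c w = 0 ->
  c = mul_linear w (div_linear c w).
Proof.
by move=> /(entireP (nrm w))[s [A [s0 ws cA]]]; exact: div_linear_root cA ws.
Qed.

Lemma entire_deriv c : entire c -> entire (formal_deriv c).
Proof.
move=> ce s s0.
have s20 : 0 < 2 * s by rewrite mulr_gt0.
have [A cA] := ce _ s20; exists (A / s) => n.
rewrite ler_pdivlMr// /formal_deriv nrmM nrm_nat.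
rewrite (_ : _ * s = n.+1%:R * (nrm (c n.+1) * s ^+ n.+1)); last first.
  by rewrite exprS; ring.
apply: le_trans (cA n.+1); rewrite exprMn [leRHS]mulrCA ler_wpM2r//.
  by rewrite mulr_ge0 ?nrm_ge0// exprn_ge0// ltW.
by rewrite -natrX ler_nat; exact: ltnW (ltn_expl _ _).
Qed.

Lemma deriv_mul_linear w d n :
  formal_deriv (mul_linear w d) n = d n + mul_linear w (formal_deriv d) n.
Proof.
rewrite /formal_deriv /mul_linear; case: n => [|n]; first by ring.
by rewrite -[n.+2]addn1 natrD; ring.
Qed.

(** Comparing [c' = d + (X - w) d'] with [c = c(w) + (X - w) d] at [w] avoids
    exchanging a double sum. *)
Lemma ps_val_deriv c w : entire c -> ps_val (formal_deriv c) w = ps_val (div_linear c w) w.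
Proof.
move=> ce; have de := entire_div_linear w ce.
have [s [A [s0 ws cA]]] := entireP (nrm w) ce.
have -> : formal_deriv c = fun n =>
    div_linear c w n + mul_linear w (formal_deriv (div_linear c w)) n.
  apply/funext => n; rewrite -deriv_mul_linear /formal_deriv.
  by rewrite {1}(div_linearP s0 cA ws) /ps_const/= add0r.
have [h1 e1] := ps_cvg_mul_linear w (entire_ps_cvg w (entire_deriv de)).
have [_ ->] := ps_cvgD (entire_ps_cvg w de) h1.
by rewrite e1 subrr mul0r addr0.
Qed.

Lemma derive1_ps_val c : entire c -> derive1 (ps_val c) = ps_val (formal_deriv c).
Proof.
move=> ce; apply/funext => a; rewrite ps_val_deriv// /derive1.
set d := div_linear c a; have de : entire d := entire_div_linear a ce.
have [s [A [s0 as_ dA]]] := entireP (nrm a + 1) de.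
apply: cvg_lim; first exact: norm_hausdorff.
have st : 0 < s - (nrm a + 1) by rewrite subr_gt0.
have lin h : nrm h <= 1 ->
    nrm (ps_val d (h + a) - ps_val d a) <= nrm h * (A * s / (s - (nrm a + 1)) ^+ 2).
  move=> h1; have := @ps_val_lipschitz _ s (nrm a + 1) A d (h + a) a s0 dA.
  rewrite addrK => H; apply: le_trans (H _ _ as_) _.
  - by rewrite (le_trans (nrmD _ _))// addrC lerD2l.
  - by rewrite lerDl.
  - by rewrite -!mulrA mulrCA.
have cv : ps_val d (h + a) @[h --> 0^'] --> ps_val d a.
  set M := A * s / _ in lin.
  have M0 : 0 <= M.
    by rewrite divr_ge0 ?sqr_ge0// mulr_ge0 ?(coef_bd_ge0 dA)// ltW.
  apply/cvg_nrm/cvgrPdist_lt => e e0; near=> h.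
  rewrite sub0r normrN ger0_norm ?nrm_ge0//.
  have h1 : nrm h < Num.min 1 (e / (M + 1)).
    have : `|h| < real_cplx (Num.min 1 (e / (M + 1))).
      near: h; apply: dnbhs0_lt.
      rewrite ltcE /= eqxx lt_min ltr01 divr_gt0//.
      by rewrite ltr_wpDl.
    by rewrite normE ltcE /= => /andP[].
  move: h1; rewrite lt_min => /andP[h1 he].
  rewrite (le_lt_trans (lin h (ltW h1)))//.
  have M1 : 0 < M + 1 by rewrite ltr_wpDl.
  move: he; rewrite ltr_pdivlMr//; apply: le_lt_trans.
  by rewrite ler_wpM2l ?nrm_ge0// lerDl.
apply: cvg_trans cv; apply: near_eq_cvg; near=> h.
have h0 : h != 0 by near: h; exact: nbhs_dnbhs_neq.
have [u [B [u0 ut cB]]] := entireP (Num.max (nrm (h + a)) (nrm a)) ce.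
move: ut; rewrite gt_max => /andP[ut1 ut2].
by rewrite /= (ps_val_sub u0 cB ut1 ut2) addrK -/d /GRing.scale/= mulKf.
Unshelve. all: by end_near. Qed.

Lemma entire_derivn c j : entire c -> entire (iter j formal_deriv c).
Proof. by move=> ce; elim: j => //= j IH; exact: entire_deriv. Qed.

Lemma derive1n_ps_val c j : entire c ->
  derive1n j (ps_val c) = ps_val (iter j formal_deriv c).
Proof.
move=> ce; elim: j => //= j IH.
rewrite -derive1_ps_val; last exact: entire_derivn.
by rewrite -IH.
Qed.

(** Leibniz rule: the second derivative of a linear factor is zero. When
    [j = 0] the ill-defined [j.-1] is multiplied by zero. *)
Lemma derivn_mul_linear w d j n : iter j formal_deriv (mul_linear w d) n =
  j%:R * iter j.-1 formal_deriv d n + mul_linear w (iter j formal_deriv d) n.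
Proof.
elim: j n => [|j IH] n; first by rewrite mul0r add0r.
rewrite iterS /formal_deriv IH -/formal_deriv mulrDr.
rewrite -[_ * mul_linear _ _ _]/(formal_deriv (mul_linear w (iter j formal_deriv d)) n).
rewrite deriv_mul_linear -iterS addrA; congr (_ + _).
case: j {IH} => [|j]; first by rewrite !mul0r mulr0 add0r mul1r.
rewrite !succnK -[in RHS]natr1 mulrDl mul1r; congr (_ + _).
exact: mulrCA.
Qed.

Lemma ps_val_derivn_mul_linear w d j z : entire d ->
  ps_val (iter j formal_deriv (mul_linear w d)) z =
  j%:R * ps_val (iter j.-1 formal_deriv d) z +
  (z - w) * ps_val (iter j formal_deriv d) z.
Proof.
move=> de.
have [h1 <-] := ps_cvg_mul_linear w (entire_ps_cvg z (entire_derivn j de)).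
have [h2 <-] := ps_cvgZ j%:R (entire_ps_cvg z (entire_derivn j.-1 de)).
have [_ <-] := ps_cvgD h2 h1; congr (ps_val _ z).
by apply/funext => n; exact: derivn_mul_linear.
Qed.

(** Vanishing to order at least [k], on the level of coefficients. *)
Definition vanish c z (k : nat) :=
  forall j, (j < k)%N -> ps_val (iter j formal_deriv c) z = 0.

Lemma vanish_mul_linear_same w d k : entire d ->
  vanish (mul_linear w d) w k.+1 <-> vanish d w k.
Proof.
move=> de; split=> h j jk.
  have := h j.+1 jk; rewrite ps_val_derivn_mul_linear// subrr mul0r addr0 => /eqP.
  by rewrite mulf_eq0 pnatr_eq0 => /eqP.
rewrite ps_val_derivn_mul_linear// subrr mul0r addr0.
by case: j jk => [|j] jk; rewrite ?mul0r// h// mulr0.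
Qed.

Lemma vanish_mul_linear_other w d k z : entire d -> z != w ->
  vanish (mul_linear w d) z k <-> vanish d z k.
Proof.
move=> de zw; split=> h j jk.
  elim: j jk => [|j IH] jk; have := h _ jk; rewrite ps_val_derivn_mul_linear//.
    rewrite mul0r add0r => /eqP; rewrite mulf_eq0 subr_eq0 (negPf zw).
    by move/eqP.
  rewrite IH ?(ltnW jk)// mulr0 add0r => /eqP.
  by rewrite mulf_eq0 subr_eq0 (negPf zw) => /eqP.
rewrite ps_val_derivn_mul_linear// (h j jk) mulr0 addr0.
by case: j jk => [|j] jk; rewrite ?mul0r// h ?mulr0// ltnW.
Qed.

Lemma multiplicityE c z : entire c -> zero_multiplicity (ps_val c) z =
  ereal_sup [set (k%:R : R)%:E | k in vanish c z].
Proof.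
move=> ce; rewrite /zero_multiplicity; congr ereal_sup.
have e j : derive1n j (ps_val c) z = ps_val (iter j formal_deriv c) z.
  by rewrite derive1n_ps_val.
by apply/seteqP; split => x [k /= h <-]; exists k => //= j jk;
  have := h j jk; rewrite e.
Qed.

Lemma multiplicity_ge0 (f : Cplx R -> Cplx R) z : (0 <= zero_multiplicity f z)%E.
Proof. by apply: ereal_sup_ubound; exists 0%N. Qed.

Lemma entire_mul_linear w d : entire d -> entire (mul_linear w d).
Proof.
move=> de s s0; have [A dA] := de s s0.
exists (A * s + nrm w * A) => n; have A0 := coef_bd_ge0 dA.
have sn : 0 <= s ^+ n by rewrite exprn_ge0// ltW.
rewrite /mul_linear (le_trans (ler_wpM2r sn (nrmB _ _)))// mulrDl lerD//; last first.
  by rewrite nrmM -mulrA ler_wpM2l ?nrm_ge0.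
case: n sn => [|n] sn; first by rewrite nrm0 mul0r mulr_ge0// ltW.
by rewrite exprSr mulrA ler_wpM2r// ltW.
Qed.

(** Valid for [d = 0] too, where both sides are infinite at every point. *)
Lemma multiplicity_mul_linear w d z : entire d ->
  zero_multiplicity (ps_val (mul_linear w d)) z =
  (zero_multiplicity (ps_val d) z + (z == w)%:R%:E)%E.
Proof.
move=> de; have me := entire_mul_linear w de.
rewrite !multiplicityE//; case: eqVneq => [->|zw]; last first.
  rewrite adde0; congr ereal_sup; apply/seteqP.
  by split => x [k /= /(vanish_mul_linear_other k de zw) h <-]; exists k.
apply/eqP; rewrite eq_le; apply/andP; split.
  apply: ub_ereal_sup => x [[|k] /= h <-].
    by rewrite adde_ge0// ereal_sup_ubound//; exists 0%N.
  move/(vanish_mul_linear_same w k de) : h => h.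
  rewrite -addn1 natrD EFinD leeD2r// ereal_sup_ubound//.
  by exists k.
rewrite -leeBrDr//; apply: ub_ereal_sup => x [k /= h <-].
rewrite -[X in (_ <= _ + X)%E]/(- 1%:E)%E leeBrDr// -EFinD natr1 ereal_sup_ubound//.
by exists k.+1 => //; apply/vanish_mul_linear_same.
Qed.

Lemma num_zeros_mul_linear w d r : entire d -> nrm w < r ->
  num_zeros (ps_val (mul_linear w d)) r = (num_zeros (ps_val d) r + 1)%E.
Proof.
move=> de wr; rewrite /num_zeros.
under eq_esum do rewrite multiplicity_mul_linear//.
rewrite esumD; [|by move=> *; exact: multiplicity_ge0|by move=> *; rewrite lee_fin].
congr (_ + _)%E.
rewrite esum_mkcond -[RHS](@esum_set1 R _ w (fun=> 1%E))// [RHS]esum_mkcond.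
apply: eq_esum => z _; case: eqVneq => [->|/eqP zw]; last first.
  by rewrite (@memNset _ [set w] z)//; case: ifP.
by rewrite !mem_set//= normE ltcE /= eqxx.
Qed.

(** At least [m] zeros, with multiplicity, in the disk: zeros can be divided
    out [m] times in succession. *)
Fixpoint has_zeros (m : nat) c r : Prop :=
  if m is k.+1 then
    exists w, [/\ nrm w < r, ps_val c w = 0 & has_zeros k (div_linear c w) r]
  else True.

Lemma num_zerosP m c r : entire c ->
  (m%:R%:E <= num_zeros (ps_val c) r)%E <-> has_zeros m c r.
Proof.
elim: m c => [|m IH] c ce /=.
  by split => // _; apply: esum_ge0 => *; exact: multiplicity_ge0.
have key w : nrm w < r -> ps_val c w = 0 ->
    (m.+1%:R%:E <= num_zeros (ps_val c) r)%E <-> has_zeros m (div_linear c w) r.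
  move=> wr cw; rewrite {1}(entire_div_linear_root ce cw).
  have de := entire_div_linear w ce.
  by rewrite num_zeros_mul_linear// -IH// -natr1 EFinD leeD2rE.
split; last by move=> [w [wr cw h]]; apply/(key w).
move=> h; have [[w wr cw]|nz] := pselect (exists2 w, nrm w < r & ps_val c w = 0).
  by exists w; split => //; apply/(key w).
exfalso; move: h; rewrite /num_zeros esum1; first by rewrite lee_fin lern0.
move=> z /= zr; rewrite multiplicityE//.
rewrite (_ : [set _ | _ in _] = [set 0%E]) ?ereal_sup1//.
apply/seteqP; split => x /=; last by move=> ->; exists 0%N.
move=> [[|k] /= h <-]//; exfalso; apply: nz; exists z; last exact: (h 0%N).
by move: zr; rewrite normE ltcE /= => /andP[].
Qed.

End zero_counting.

(** * Coefficients of a series with many zeros; limits of approximate zeros *)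
Section zeros_of_perturbed_series.
Context {R : realType}.
Implicit Types (c d : nat -> Cplx R) (z w : Cplx R) (s t A B r : R).

(** By induction, [c = (X - w) d] with the quotient [d] having one zero less.
    The coefficients of [d] of index below its own number of zeros are small
    by induction, the next one by its growth bound because [s >= s - r];
    multiplying back by [X - w] at most multiplies by [1 + r <= 2 rho]. *)
Lemma has_zeros_coef_le m c s r rho A : 0 < r -> r < s -> r <= rho ->
  1 <= rho -> coef_bd s A c -> has_zeros m c r ->
  forall k, (k < m)%N -> nrm (c k) <= A * (2 * rho) ^+ m / (s - r) ^+ m.
Proof.
move=> r0 rs rrho rho1; have s0 : 0 < s by rewrite (lt_trans r0).
have sr : 0 < s - r by rewrite subr_gt0.
have rho0 : 0 < rho by rewrite (lt_le_trans ltr01).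
elim: m A c => // m IH A c cA /= [w [wr cw dz]] k km.
have dA := coef_bd_div_linear s0 cA (ltW wr) rs.
have A0 := coef_bd_ge0 dA.
set X := A / (s - r) * (2 * rho) ^+ m / (s - r) ^+ m.
have A0' := coef_bd_ge0 cA.
have X0 : 0 <= X by rewrite !(mulr_ge0, invr_ge0, exprn_ge0)// ltW.
have dX i : (i <= m)%N -> nrm (div_linear c w i) <= X.
  rewrite leq_eqVlt => /orP[/eqP ->|im]; last exact: (IH _ _ dA dz i im).
  have := dA m; rewrite -ler_pdivlMr ?exprn_gt0// => /le_trans; apply.
  rewrite /X -[leRHS]mulrA ler_wpM2l//.
  rewrite -[leLHS]mul1r ler_pM ?invr_ge0 ?exprn_ge0 ?(ltW s0)//.
    by rewrite exprn_ege1//; lra.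
  rewrite lef_pV2 ?posrE ?exprn_gt0// lerXn2r// ?nnegrE ?ltW//.
  by rewrite gtrBl.
rewrite (div_linear_root s0 cA (lt_trans wr rs) cw) /mul_linear.
have -> : A * (2 * rho) ^+ m.+1 / (s - r) ^+ m.+1 = rho * X + rho * X.
  rewrite /X !exprS; field.
  by rewrite ?expf_neq0 gt_eqF.
rewrite (le_trans (nrmB _ _))// lerD//; last first.
  rewrite nrmM ler_pM ?nrm_ge0// ?(le_trans (ltW wr))//.
  by rewrite dX.
apply: (@le_trans _ _ X); last by rewrite ler_peMl.
by case: k km => [|k] km; rewrite ?nrm0// dX// ltnW.
Qed.

(** Successive quotients by a sequence of points which need not be zeros, so
    that they depend continuously on the points. *)
Fixpoint div_linears c (zs : nat -> Cplx R) j :=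
  if j is k.+1 then div_linear (div_linears c zs k) (zs k) else c.

Lemma div_linears_recl c zs j :
  div_linears c zs j.+1 = div_linears (div_linear c (zs 0%N)) (fun i => zs i.+1) j.
Proof. by elim: j => //= j ->. Qed.

Lemma has_zerosE m c r : has_zeros m c r <->
  exists zs, forall j, (j < m)%N -> nrm (zs j) < r /\ ps_val (div_linears c zs j) (zs j) = 0.
Proof.
elim: m c => [|m IH] c /=; first by split=> // _; exists (fun=> 0).
split=> [[w [wr cw /IH[zs h]]]|[zs h]].
  exists (fun j => if j is i.+1 then zs i else w) => -[|j] jm //.
  by rewrite div_linears_recl; exact: h.
exists (zs 0%N); have [h1 h2] := h 0%N isT; split=> //.
apply/IH; exists (fun i => zs i.+1) => j jm.
by have := h j.+1 jm; rewrite div_linears_recl.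
Qed.

Lemma div_linearB s A B c d w : 0 < s -> coef_bd s A c ->
  coef_bd s B d -> nrm w < s ->
  div_linear (fun n => c n - d n) w = fun n => div_linear c w n - div_linear d w n.
Proof.
move=> s0 cA dB ws; apply/funext => n; rewrite /div_linear.
have h1 := coef_bd_cvg s0 (coef_bd_tail n.+1 s0 cA) ws.
have h2 := coef_bd_cvg s0 (coef_bd_tail n.+1 s0 dB) ws.
have [h3 e3] := ps_cvgZ (-1) h2.
have [_ e4] := ps_cvgD h1 h3.
rewrite -mulN1r -e3 -e4; congr (ps_val _ w).
by apply/funext => k; rewrite /ps_tail mulN1r.
Qed.

Lemma ps_valB s A B c d w : 0 < s -> coef_bd s A c -> coef_bd s B d -> nrm w < s ->
  ps_val (fun n => c n - d n) w = ps_val c w - ps_val d w.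
Proof.
move=> s0 cA dB ws.
have h1 := coef_bd_cvg s0 cA ws; have [h3 e3] := ps_cvgZ (-1) (coef_bd_cvg s0 dB ws).
have [_ e4] := ps_cvgD h1 h3.
rewrite -mulN1r -e3 -e4; congr (ps_val _ w).
by apply/funext => k; rewrite mulN1r.
Qed.

Lemma eq_coef_bd s A c d : c =1 d -> coef_bd s A c -> coef_bd s A d.
Proof. by move=> cd h n; rewrite -cd. Qed.

Section perturbation.
Context (T : Type) (F : set_system T) {FF : Filter F}.
Variables (c : nat -> Cplx R) (s rho A : R) (m : nat).
Variables (zs : T -> nat -> Cplx R) (z : nat -> Cplx R).
Hypotheses (s0 : 0 < s) (rhos : rho < s) (cA : coef_bd s A c).
Hypothesis zs_rho : forall (t : T) j, (j < m)%N -> nrm (zs t j) <= rho.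
Hypothesis z_rho : forall j, (j < m)%N -> nrm (z j) <= rho.
Hypothesis zs_z : forall j, (j < m)%N -> (fun t : T => zs t j) @ F --> z j.

Lemma cvg_lincomb0 (u v : T -> R) a b : u @ F --> (0 : R) -> v @ F --> (0 : R) ->
  (fun t : T => a * u t + b * v t) @ F --> (0 : R).
Proof.
move=> u0 v0; rewrite -[X in _ --> X](_ : a * 0 + b * 0 = 0 :> R).
  exact: (cvgD (cvgM (cvg_cst a) u0) (cvgM (cvg_cst b) v0)).
by rewrite !mulr0 addr0.
Qed.

(** The quotients converge in the weighted norm, with radius [s] unchanged:
    one more division multiplies the error by [1 / (s - rho)] and adds a
    Lipschitz term in the displacement of the point. *)
Lemma div_linears_cvg j : (j <= m)%N ->
  exists B, coef_bd s B (div_linears c z j) /\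
  exists2 E : T -> R, E @ F --> (0 : R) &
    forall t : T, coef_bd s (E t) (fun n => div_linears c (zs t) j n - div_linears c z j n).
Proof.
elim: j => [_|j IH jm].
  exists A; split => //; exists (fun=> 0); first exact: cvg_cst.
  by move=> t n; rewrite subrr nrm0 mul0r.
have [B [qB [E E0 qE]]] := IH (ltnW jm).
exists (B / (s - rho)); split; first exact: coef_bd_div_linear (z_rho jm) rhos.
exists (fun t : T => (s - rho)^-1 * E t +
                 B / (s - rho) ^+ 2 * nrm (zs t j - z j)).
  by apply: cvg_lincomb0 => //; apply/cvg_nrm; exact: zs_z.
move=> t; rewrite mulrC.
have qt : coef_bd s (E t + B) (div_linears c (zs t) j).
  by apply: eq_coef_bd (coef_bdD s0 (qE t) qB) => n; rewrite subrK.
have zt := zs_rho t jm.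
have h1 := coef_bd_div_linear s0 (qE t) zt rhos.
have h2 := div_linear_lipschitz s0 qB zt (z_rho jm) rhos.
rewrite [B / _ * _]mulrAC.
apply: eq_coef_bd (coef_bdD s0 h1 h2) => n /=.
by rewrite (div_linearB s0 qt qB (le_lt_trans zt rhos)) addrA subrK.
Qed.

Lemma ps_val_div_linears_cvg j : (j < m)%N ->
  (fun t : T => ps_val (div_linears c (zs t) j) (zs t j)) @ F -->
  ps_val (div_linears c z j) (z j).
Proof.
move=> jm; have [B [qB [E E0 qE]]] := div_linears_cvg (ltnW jm).
apply/cvg_nrm.
pose v (t : T) := (s / (s - rho)) * E t +
            B * s / (s - rho) ^+ 2 * nrm (zs t j - z j).
apply: (@cvg_squeeze0 _ _ _ _ _ v); last first.
  by apply: cvg_lincomb0 => //; apply/cvg_nrm; exact: zs_z.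
move=> t; rewrite nrm_ge0 /=.
have qt : coef_bd s (E t + B) (div_linears c (zs t) j).
  by apply: eq_coef_bd (coef_bdD s0 (qE t) qB) => n; rewrite subrK.
have zt := zs_rho t jm.
rewrite (le_trans (nrm_distD (ps_val (div_linears c z j) (zs t j)) _ _))// lerD//.
  rewrite -(ps_valB s0 qt qB (le_lt_trans zt rhos)).
  rewrite (le_trans (ps_val_le s0 (qE t) zt rhos))// le_eqVlt.
  by apply/orP; left; apply/eqP; ring.
rewrite (le_trans (ps_val_lipschitz s0 qB zt (z_rho jm) rhos))//.
by rewrite le_eqVlt; apply/orP; left; apply/eqP; ring.
Qed.

End perturbation.

Lemma ultra_cvg_real (U : set_system nat) (y : nat -> R) b :
  UltraFilter U -> (forall n, `|y n| <= b) -> exists l : R, y @ U --> l.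
Proof.
move=> UU yb; have PU := @ultra_proper _ _ UU.
have := @segment_compact R (- b) b.
move=> /(_ (y @ U) _) [|l [_ lcl]].
  by apply: (@filterE _ U _ (y @^-1` _)) => n /=; rewrite in_itv /= -ler_norml yb.
exists l => N lN.
have [//|h] := in_ultra_setVsetC (y @^-1` N) UU.
have [x [/= nx Nx]] := lcl (~` N) N h lN.
by [].
Qed.

(** Limits along one ultrafilter exist for all bounded sequences at once, which
    avoids extracting subsequences for tuples of points. *)
Lemma ultra_cvg_cplx (U : set_system nat) (y : nat -> Cplx R) b :
  UltraFilter U -> (forall n, nrm (y n) <= b) ->
  exists l : Cplx R, y @ U --> l /\ nrm l <= b.
Proof.
move=> UU yb; have PU := @ultra_proper _ _ UU.
have [l1 h1] := @ultra_cvg_real U (fun n => complex.Re (y n)) b UU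
  (fun n => le_trans (Re_nrm _) (yb n)).
have [l2 h2] := @ultra_cvg_real U (fun n => complex.Im (y n)) b UU
  (fun n => le_trans (Im_nrm _) (yb n)).
have h : y @ U --> (Complex l1 l2 : Cplx R) by apply/cvg_ReIm.
exists (Complex l1 l2); split => //.
by apply: cvg_nrm_le h yb.
Qed.

(** Points with rational coordinates read off finite lists, so that finite
    tuples of points are indexed by a countable type. *)
Definition rat_pts (q : seq (rat * rat)) (j : nat) : Cplx R :=
  Complex (ratr (nth (0, 0) q j).1) (ratr (nth (0, 0) q j).2).

Lemma rat_cplx_dense z e : 0 < e -> exists q : rat * rat,
  nrm ((Complex (ratr q.1) (ratr q.2) : Cplx R) - z) < e.
Proof.
move=> e0; have e2 : 0 < e / 2 by rewrite divr_gt0.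
have apx (x : R) : exists q : rat, `|ratr q - x| < e / 2.
  have [|q] := @rat_in_itvoo R (x - e / 2) (x + e / 2); first lra.
  by rewrite in_itv /= -ltr_distl => h; exists q.
have [q1 h1] := apx (complex.Re z); have [q2 h2] := apx (complex.Im z).
exists (q1, q2); rewrite (le_lt_trans (nrm_ReIm _))// ReB ImB /=.
by rewrite [ltRHS]splitr ltrD.
Qed.

(** Radii increasing to [r], all smaller than [r]: limits of points in the
    closed disk of such a radius stay in the open disk of radius [r]. *)
Definition inner_radius r (p : nat) : R := r * (1 - p.+2%:R^-1).

Lemma inner_radius_lt r p : 0 < r -> inner_radius r p < r.
Proof.
by move=> r0; rewrite /inner_radius gtr_pMr// gtrBl invr_gt0 ltr0n.
Qed.

Lemma inner_radius_exhaust r x : 0 < r -> x < r ->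
  exists p, x < inner_radius r p.
Proof.
move=> r0 xr; have h : 0 < 1 - x / r.
  by rewrite subr_gt0 ltr_pdivrMr// mul1r.
exists (Num.bound (1 - x / r)^-1).
have := archi_boundP (ltW (_ : 0 < (1 - x / r)^-1)); rewrite invr_gt0 => /(_ h).
set p := Num.bound _ => hp.
rewrite /inner_radius mulrC -ltr_pdivrMr// ltrBrDr -ltrBrDl.
rewrite -[ltRHS]invrK ltf_pV2 ?posrE ?invr_gt0 ?ltr0n//.
by rewrite (lt_trans hp)// ltr_nat.
Qed.

(** A countable criterion. Rational points near exact zeros are approximate
    zeros by continuity of the quotients; conversely approximate zeros in a
    fixed smaller closed disk converge along an ultrafilter to exact zeros. *)
Lemma has_zeros_approx m c r : 0 < r -> entire c ->
  has_zeros m c r <->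
  exists p : nat, forall k : nat, exists q, forall j, (j < m)%N ->
    nrm (rat_pts q j) <= inner_radius r p /\
    nrm (ps_val (div_linears c (rat_pts q) j) (rat_pts q j)) <= k.+1%:R^-1.
Proof.
move=> r0 /(_ _ r0)[A cA]; rewrite has_zerosE; split.
  move=> [z h].
  have [x xr zx] : exists2 x, x < r & forall j, (j < m)%N -> nrm (z j) <= x.
    elim: m h => [|m IH] h; first by exists 0.
    have [j jm|x xr hx] := IH; first by apply: h; rewrite ltnW.
    exists (Num.max x (nrm (z m))); first by rewrite gt_max xr (h m _).1.
    move=> j; rewrite ltnS leq_eqVlt le_max => /orP[/eqP ->|/hx ->//].
    by rewrite lexx orbT.
  have [p xp] := inner_radius_exhaust r0 xr.
  exists p => k.
  have /choice[g hg] : forall n : nat, exists q, forall j, (j < m)%N ->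
      nrm (rat_pts q j - z j) < Num.min (inner_radius r p - x) n.+1%:R^-1.
    move=> n; have e0 : 0 < Num.min (inner_radius r p - x) n.+1%:R^-1.
      by rewrite lt_min subr_gt0 xp invr_gt0 ltr0n.
    have /choice[g hg] := fun j => rat_cplx_dense (z j) e0.
    by exists (mkseq g m) => j jm; rewrite /rat_pts nth_mkseq//; exact: hg.
  have gp n j : (j < m)%N -> nrm (rat_pts (g n) j) <= inner_radius r p.
    move=> jm; have := hg n j jm; rewrite lt_min => /andP[+ _].
    have := nrm_distD (z j) (rat_pts (g n) j) 0; rewrite !subr0.
    by have := zx j jm; lra.
  have gz j : (j < m)%N -> (fun n => rat_pts (g n) j) @ \oo --> z j.
    move=> jm; apply/cvg_nrm; apply: (cvg_squeeze0 _ (@cvg_harmonic R)) => n.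
    rewrite nrm_ge0 /= ltW//; have := hg n j jm.
    by rewrite lt_min => /andP[].
  have near1 j : (j < m)%N -> \forall n \near \oo,
      nrm (ps_val (div_linears c (rat_pts (g n)) j) (rat_pts (g n) j)) <= k.+1%:R^-1.
    move=> jm.
    have : (fun n => ps_val (div_linears c (rat_pts (g n)) j) (rat_pts (g n) j)) @ \oo -->
        ps_val (div_linears c z j) (z j).
      exact: (ps_val_div_linears_cvg r0 (inner_radius_lt p r0) cA gp
        (fun j jm => le_trans (zx j jm) (ltW xp)) gz jm).
    rewrite (h j jm).2 => /cvg_nrm/cvgrPdist_lt/(_ k.+1%:R^-1).
    rewrite invr_gt0 ltr0n => /(_ isT); apply: filterS => n.
    by rewrite sub0r normrN subr0 ger0_norm ?nrm_ge0// => /ltW.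
  have [n hn] : exists n, forall j, (j < m)%N ->
      nrm (ps_val (div_linears c (rat_pts (g n)) j) (rat_pts (g n) j)) <= k.+1%:R^-1.
    have /filter_ex[n hn] : \forall n \near \oo, forall j : 'I_m,
        nrm (ps_val (div_linears c (rat_pts (g n)) j) (rat_pts (g n) j)) <= k.+1%:R^-1.
      by apply: filter_forall => j; exact: near1.
    by exists n => j jm; exact: (hn (Ordinal jm)).
  by exists (g n) => j jm; split; [exact: gp|exact: hn].
move=> [p /choice[g hg]].
have [U [UU oU]] := ultraFilterLemma (@eventually_filter).
have PU := @ultra_proper _ _ UU.
have /choice[z hz] : forall j, exists l, (j < m)%N ->
    (fun k => rat_pts (g k) j) @ U --> l /\ nrm l <= inner_radius r p.
  move=> j; have [jm|] := boolP (j < m)%N; last by exists 0.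
  have [l h] := ultra_cvg_cplx UU (fun k => (hg k j jm).1).
  by exists l.
exists z => j jm; split.
  exact: le_lt_trans (hz j jm).2 (inner_radius_lt p r0).
have lim1 : (fun k => ps_val (div_linears c (rat_pts (g k)) j) (rat_pts (g k) j)) @ U -->
    ps_val (div_linears c z j) (z j).
  apply: (ps_val_div_linears_cvg r0 (inner_radius_lt p r0) cA
  (fun k j jm => (hg k j jm).1) (fun j jm => (hz j jm).2)
  (fun j jm => (hz j jm).1) jm).
apply: (@cvg_unique _ (@norm_hausdorff _ (Cplx R)) _ _ _ _ lim1).
apply/cvg_nrm; apply: (@cvg_squeeze0 _ _ _ _ _ (@harmonic R)) => [k|].
  by rewrite nrm_ge0 subr0; exact: (hg k j jm).2.
apply: cvg_trans (@cvg_harmonic R).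
by move=> B /oU.
Qed.

End zeros_of_perturbed_series.

(** * Weierstrass preparation and series with a dominant coefficient *)
Section weierstrass_preparation.
Context {R : realType}.
Implicit Types (b c d g : nat -> Cplx R) (u w : Cplx R) (s A B r : R).

Definition cauchy_prod b g n : Cplx R := \sum_(j < n.+1) b (n - j)%N * g j.

Lemma cauchy_prod_mul_linear w d g n :
  cauchy_prod (mul_linear w d) g n = mul_linear w (cauchy_prod d g) n.
Proof.
rewrite /cauchy_prod /mul_linear.
under eq_bigr do rewrite mulrBl -mulrA.
rewrite sumrB -mulr_sumr; congr (_ - _).
case: n => [|n]; first by rewrite big_ord1 mul0r.
rewrite big_ord_recr /= subnn mul0r addr0.
by apply: eq_bigr => j _; rewrite subSn// -ltnS ltn_ord.
Qed.

Lemma cauchy_prod_const v g n : cauchy_prod (ps_const v) g n = v * g n.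
Proof.
rewrite /cauchy_prod big_ord_recr /= subnn big1 ?add0r// => j _.
by rewrite /ps_const subn_eq0 leqNgt ltn_ord mul0r.
Qed.

Lemma cauchy_prodDl b d g n :
  cauchy_prod (fun n => b n + d n) g n = cauchy_prod b g n + cauchy_prod d g n.
Proof. by rewrite /cauchy_prod -big_split; apply: eq_bigr => j _; rewrite mulrDl. Qed.

Lemma mul_linear_inj w d : (forall n, mul_linear w d n = 0) -> forall n, d n = 0.
Proof.
rewrite /mul_linear => h; have [w0|w0] := eqVneq w 0.
  by move=> n; have := h n.+1; rewrite w0 mul0r subr0.
elim=> [|n IH].
  have /eqP := h 0%N; rewrite sub0r oppr_eq0 mulf_eq0 (negPf w0).
  by move/eqP.
have /eqP := h n.+1; rewrite IH sub0r oppr_eq0 mulf_eq0 (negPf w0).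
by move/eqP.
Qed.

(** The coefficients grow at most linearly, which any smaller radius absorbs;
    [3/4] lies between [1] and the radius [1/2] where the roots are located. *)
Lemma coef_bd_cauchy_prod A B d g : coef_bd 1 A d -> coef_bd 1 B g ->
  coef_bd (3 / 4) (A * B * 3) (cauchy_prod d g).
Proof.
move=> dA gB n.
have A0 := coef_bd_ge0 dA; have B0 := coef_bd_ge0 gB.
have h : nrm (cauchy_prod d g n) <= A * B * n.+1%:R.
  rewrite (le_trans (nrm_sum _ _ _))//.
  rewrite (@le_trans _ _ (\sum_(j < n.+1) A * B))//; last first.
    by rewrite sumr_const card_ord mulr_natr.
  apply: ler_sum => j _; rewrite nrmM ler_pM ?nrm_ge0//.
    by have := dA (n - j)%N; rewrite expr1n mulr1.
  by have := gB j; rewrite expr1n mulr1.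
have h3 : n.+1%:R <= 3 * (4 / 3) ^+ n :> R.
  elim: n {h} => [|n IH]; first by rewrite expr0; lra.
  rewrite -natr1 exprS.
  have : 1 <= (4 / 3) ^+ n :> R by rewrite exprn_ege1//; lra.
  by move: IH; lra.
have h4 : (3 / 4) ^+ n * (4 / 3) ^+ n = 1 :> R.
  by rewrite -exprMn (_ : 3 / 4 * (4 / 3) = 1) ?expr1n//; lra.
have p0 : 0 <= (3 / 4) ^+ n :> R by rewrite exprn_ge0//; lra.
apply: (le_trans (ler_wpM2r p0 h)).
rewrite -[leLHS]mulrA; apply: ler_wpM2l; first exact: mulr_ge0.
apply: (le_trans (ler_wpM2r p0 h3)).
by rewrite -mulrA [_ * (3 / 4) ^+ n]mulrC h4 mulr1.
Qed.

Lemma coef_bd_poly (p : {poly Cplx R}) : exists A, coef_bd 1 A (fun n => p`_n).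
Proof.
exists (\sum_(i < size p) nrm p`_i) => n; rewrite expr1n mulr1.
have [np|np] := ltnP n (size p); last first.
  by rewrite nth_default// nrm0 sumr_ge0// => i _; exact: nrm_ge0.
rewrite (bigD1 (Ordinal np))//= lerDl sumr_ge0// => i _; exact: nrm_ge0.
Qed.

(** A root [u] of the product where [g] does not vanish is a zero of [b]; the
    linear factor can then be cancelled on both sides, and the quotient of [b]
    satisfies the same hypotheses with one root less. *)
Lemma has_zeros_of_cauchy_prod (rs : seq (Cplx R)) b g B G : coef_bd 1 B b -> coef_bd 1 G g ->
  (forall u, u \in rs -> nrm u <= 1 / 2 /\ ps_val g u != 0) ->
  (forall n, cauchy_prod b g n = (\prod_(u <- rs) ('X - u%:P))`_n) ->
  has_zeros (size rs) b 1.
Proof.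
move=> + gG; elim: rs b B => [//|u rs IH] b B bB hrs bg /=.
have [u2 gu] := hrs u (mem_head _ _).
have half1 : 1 / 2 < 1 :> R by lra.
have u1 : nrm u < 1 by rewrite (le_lt_trans u2).
set d := div_linear b u; set p := \prod_(v <- rs) ('X - v%:P).
have dB : coef_bd 1 _ d := coef_bd_div_linear ltr01 bB u2 half1.
pose X n := p`_n - cauchy_prod d g n.
(* from [b = b(u) + (T - u) d] and [b g = (T - u) p], with indeterminate [T],
   follows [b(u) g = (T - u) (p - d g)] *)
have step n : ps_val b u * g n = mul_linear u X n.
  have e := bg n.
  rewrite {1}(div_linearP ltr01 bB u1) cauchy_prodDl in e.
  rewrite cauchy_prod_const cauchy_prod_mul_linear in e.
  apply: (addIr (mul_linear u (cauchy_prod d g) n)); rewrite e big_cons -/p.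
  rewrite mulrBl coefB coefXM coefCM /X /mul_linear.
  by case: n {e} => [|n] /=; ring.
have [K pK] := coef_bd_poly p.
have Xcvs : ps_cvg X u.
  have h1 := coef_bd_cvg ltr01 pK u1.
  have s0 : 0 < 3 / 4 :> R by lra.
  have us : nrm u < 3 / 4 by rewrite (le_lt_trans u2)//; lra.
  have [h2 _] := ps_cvgZ (-1) (coef_bd_cvg s0 (coef_bd_cauchy_prod dB gG) us).
  have [h3 _] := ps_cvgD h1 h2.
  rewrite (_ : X = fun n => p`_n + -1 * cauchy_prod d g n)//.
  by apply/funext => n; rewrite mulN1r.
have bu : ps_val b u = 0.
  have [_ e1] := ps_cvg_mul_linear u Xcvs.
  have [_ e2] := ps_cvgZ (ps_val b u) (coef_bd_cvg ltr01 gG u1).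
  have /eqP : ps_val b u * ps_val g u = 0.
    rewrite -e2 (_ : (fun n => _) = mul_linear u X); last exact/funext.
    by rewrite e1 subrr mul0r.
  by rewrite mulf_eq0 (negPf gu) orbF => /eqP.
exists u; split => //; apply: (IH _ _ dB) => [v vrs|n].
  by apply: hrs; rewrite in_cons vrs orbT.
apply/esym/eqP; rewrite -subr_eq0; apply/eqP; apply: (@mul_linear_inj u X) => k.
by rewrite -step bu mul0r.
Qed.

Lemma ps_cvg_sum (I : Type) (l : seq I) (P : pred I) (a : I -> Cplx R)
    (c : I -> nat -> Cplx R) w : (forall i, ps_cvg (c i) w) ->
  ps_cvg (fun n => \sum_(i <- l | P i) a i * c i n) w /\
  ps_val (fun n => \sum_(i <- l | P i) a i * c i n) w =
  \sum_(i <- l | P i) a i * ps_val (c i) w.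
Proof.
move=> hc; elim: l => [|i l [IH1 IH2]].
  under [X in ps_cvg X]eq_fun do rewrite big_nil.
  under [X in ps_val X]eq_fun do rewrite big_nil.
  by rewrite big_nil ps_val0; split => //; exact: ps_cvg0.
have [Pi|nPi] := boolP (P i); last first.
  under [X in ps_cvg X]eq_fun do rewrite big_cons (negPf nPi).
  under [X in ps_val X]eq_fun do rewrite big_cons (negPf nPi).
  by rewrite [RHS]big_cons (negPf nPi) -IH2; split; [exact: IH1|].
under [X in ps_cvg X]eq_fun do rewrite big_cons Pi.
under [X in ps_val X]eq_fun do rewrite big_cons Pi.
have [h1 e1] := ps_cvgZ (a i) (hc i).
have [h2 e2] := ps_cvgD h1 IH1.
by rewrite [RHS]big_cons Pi -e1 -IH2 -e2; split; [exact: h2|].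
Qed.

(** The coefficients of [b] are normalised by [b m = 1] and all the others add
    up to at most [1/4], so multiplication by [b] followed by deletion of the
    [m] lowest coefficients is a perturbation of size [1/4] of the identity
    of the space of bounded sequences. *)
Section neumann.
Variables (b : nat -> Cplx R) (m : nat).
Hypothesis bm : b m = 1.
Hypothesis b_off : forall N, \sum_(i < N | i != m :> nat) nrm (b i) <= 1 / 4.

(** The [k]-th term of the Neumann series solving
    [(b g)_(n + m) = (n == 0)] for all [n]. *)
Fixpoint neumann k n : Cplx R :=
  if k is l.+1 then
    - \sum_(j < (n + m).+1 | j != n :> nat) b (n + m - j)%N * neumann l j
  else ps_const 1 n.

Lemma neumann_le k n : nrm (neumann k n) <= (1 / 4) ^+ k.
Proof.
elim: k n => [|k IH] n /=.
  by rewrite expr0 /ps_const; case: ifP; rewrite ?nrm1 ?nrm0.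
rewrite nrmN (le_trans (nrm_sum _ _ _))//.
rewrite (@le_trans _ _ (\sum_(j < (n + m).+1 | j != n :> nat)
    nrm (b (n + m - j)%N) * (1 / 4) ^+ k))//.
  by apply: ler_sum => j _; rewrite nrmM ler_wpM2l ?nrm_ge0.
have q0 : 0 <= 1 / 4 :> R by lra.
rewrite -mulr_suml exprS ler_wpM2r ?exprn_ge0//.
apply: le_trans (b_off (n + m).+1).
rewrite (reindex_inj rev_ord_inj) /= le_eqVlt; apply/orP; left; apply/eqP.
apply: eq_big => [j|j _]; last first.
  by rewrite subSS subKn// -ltnS.
rewrite subSS; have := ltn_ord j; rewrite ltnS => jnm.
by rewrite -(eqn_add2r j) subnK// eqn_add2l eq_sym.
Qed.

Lemma coef_bd_neumann n : coef_bd 4 1 (fun k => neumann k n).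
Proof.
move=> k; rewrite (le_trans (ler_wpM2r _ (neumann_le k n)))// -exprMn.
by rewrite (_ : 1 / 4 * 4 = 1) ?expr1n//; lra.
Qed.

(** The sum over [k] is taken as the value at [1] of the power series in [k],
    whose radius of convergence is at least [4]. *)
Definition neumann_sol n := ps_val (neumann ^~ n) 1.

Let nrm1_lt4 : nrm (1 : Cplx R) < 4. Proof. by rewrite nrm1; lra. Qed.
Let lt04 : 0 < 4 :> R. Proof. by lra. Qed.
Let nrm1_le1 : nrm (1 : Cplx R) <= 1. Proof. by rewrite nrm1. Qed.
Let e41 : 4 - 1 = 3 :> R. Proof. by lra. Qed.
Let lt14 : 1 < 4 :> R. Proof. by lra. Qed.

Lemma neumann_sol_le n : nrm (neumann_sol n) <= 4 / 3.
Proof.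
apply: le_trans (ps_val_le lt04 (coef_bd_neumann n) nrm1_le1 lt14) _.
by rewrite e41; lra.
Qed.

Lemma neumann_sol_near n : nrm (neumann_sol n - ps_const 1 n) <= 1 / 3.
Proof.
have tb := coef_bd_tail 1 lt04 (coef_bd_neumann n).
have [_ e] := ps_cvg_recl (coef_bd_cvg lt04 tb nrm1_lt4).
rewrite /neumann_sol e mul1r /= addrC addKr.
apply: le_trans (ps_val_le lt04 tb nrm1_le1 lt14) _; rewrite expr1.
by rewrite e41; lra.
Qed.

(** The sum telescopes: applying the perturbed identity to the [k]-th term
    gives the difference of the terms [k] and [k.+1]. *)
Lemma cauchy_prod_neumann_sol n : cauchy_prod b neumann_sol (n + m) = ps_const 1 n.
Proof.
rewrite /cauchy_prod.
have hc (j : 'I_(n + m).+1) : ps_cvg (neumann ^~ j) 1.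
  exact: coef_bd_cvg lt04 (coef_bd_neumann j) nrm1_lt4.
have [_ <-] := @ps_cvg_sum _ (index_enum 'I_(n + m).+1) xpredT
  (fun j => b (n + m - j)%N) (fun j k => neumann k j) 1 hc.
have tcv := coef_bd_cvg lt04 (coef_bd_tail 1 lt04 (coef_bd_neumann n)) nrm1_lt4.
have [h1 e1] := ps_cvg_recl tcv.
have [h2 e2] := ps_cvgZ (-1) tcv.
have [_ e3] := ps_cvgD h1 h2.
rewrite (_ : (fun k => _) = fun k =>
    neumann k n + -1 * ps_tail (neumann ^~ n) 1 k); last first.
  apply/funext => k; rewrite /ps_tail add1n /= mulN1r opprK.
  have nm : (n < (n + m).+1)%N by rewrite ltnS leq_addr.
  by rewrite (bigD1 (Ordinal nm))//= addKn bm mul1r.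
by rewrite e3 e2 e1 mul1r mulN1r addrK.
Qed.

Hypothesis b_low : forall i, (i < m)%N -> nrm (b i) <= (4 * 8 ^+ m)^-1.

Lemma cauchy_prod_neumann_sol_low i : (i < m)%N ->
  nrm (cauchy_prod b neumann_sol i) <= m%:R / (3 * 8 ^+ m).
Proof.
move=> im; rewrite (le_trans (nrm_sum _ _ _))//.
have p8 : 0 < 8 ^+ m :> R by rewrite exprn_gt0.
rewrite (@le_trans _ _ (\sum_(j < i.+1) (3 * 8 ^+ m)^-1))//; last first.
  rewrite sumr_const card_ord -[leLHS]mulr_natl.
  by rewrite ler_wpM2r ?invr_ge0 ?ler_nat// mulr_ge0// ltW.
apply: ler_sum => j _; rewrite nrmM.
have -> : (3 * 8 ^+ m)^-1 = (4 * 8 ^+ m)^-1 * (4 / 3) :> R.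
  by field; rewrite gt_eqF.
rewrite ler_pM ?nrm_ge0// ?neumann_sol_le//.
by rewrite b_low// (leq_ltn_trans (leq_subr _ _)).
Qed.

Definition neumann_poly : {poly Cplx R} :=
  \poly_(i < m.+1) cauchy_prod b neumann_sol i.

Lemma coef_neumann_poly n : neumann_poly`_n = cauchy_prod b neumann_sol n.
Proof.
rewrite coef_poly; case: ltnP => // mn.
rewrite -(subnK (ltnW mn)) cauchy_prod_neumann_sol /ps_const subn_eq0.
by rewrite leqNgt mn.
Qed.

Lemma lead_neumann_poly : cauchy_prod b neumann_sol m = 1.
Proof. by rewrite -[m]add0n cauchy_prod_neumann_sol. Qed.

Lemma size_neumann_poly : size neumann_poly = m.+1.
Proof. by rewrite size_poly_eq// lead_neumann_poly oner_eq0. Qed.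

(** If [|u| > 1/2], each lower term of the monic polynomial is at most
    [m / (3 * 8^m) * 2^m * |u|^m]; there are [m] of them and [m <= 2^m], so
    together they cannot cancel the leading term. *)
Lemma root_neumann_poly u : root neumann_poly u -> nrm u <= 1 / 2.
Proof.
rewrite leNgt => ru; apply/negP => u2.
have u0 : 0 < nrm u by rewrite (lt_trans _ u2)//; lra.
move: ru; rewrite /root horner_poly big_ord_recr /= lead_neumann_poly mul1r.
rewrite addr_eq0 eq_sym => /eqP/(congr1 nrm).
rewrite nrmN nrmX => e.
have p8 : 0 < 8 ^+ m :> R by rewrite exprn_gt0.
have le1 : nrm u ^+ m <= m%:R * (m%:R / (3 * 8 ^+ m) * (2 ^+ m * nrm u ^+ m)).
  rewrite {1}e (le_trans (nrm_sum _ _ _))//.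
  rewrite -[X in X%:R * _]card_ord mulr_natl -sumr_const; apply: ler_sum => i _.
  rewrite nrmM ler_pM ?nrm_ge0//; first exact: cauchy_prod_neumann_sol_low.
  have -> : nrm u ^+ m = nrm u ^+ i * nrm u ^+ (m - i).
    by rewrite -exprD subnKC// ltnW.
  rewrite nrmX mulrCA.
  rewrite ler_peMr ?exprn_ge0 ?nrm_ge0//.
  rewrite (@le_trans _ _ ((2 * nrm u) ^+ (m - i)))//.
    by rewrite exprn_ege1//; lra.
  rewrite exprMn ler_wpM2r ?exprn_ge0 ?nrm_ge0// ler_weXn2l ?leq_subr//; lra.
have um : 0 < nrm u ^+ m by rewrite exprn_gt0.
have m2 : m%:R <= 2 ^+ m :> R by rewrite -natrX ler_nat; exact: ltnW (ltn_expl _ _).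
have : m%:R * (m%:R / (3 * 8 ^+ m) * (2 ^+ m * nrm u ^+ m)) <= 1 / 3 * nrm u ^+ m.
  rewrite !mulrA ler_wpM2r ?(ltW um)//.
  rewrite [X in _ / X]mulrC invfM.
  rewrite (_ : m%:R * m%:R * _ * _ =
    (m%:R * m%:R * 2 ^+ m) * (8 ^+ m)^-1 * (1 / 3)); last first.
    by field; rewrite gt_eqF.
  rewrite ler_piMl// ler_pdivrMr// mul1r.
  have -> : 8 ^+ m = 2 ^+ m * 2 ^+ m * 2 ^+ m :> R.
    by rewrite -!exprMn; congr (_ ^+ m); lra.
  by rewrite ler_wpM2r ?exprn_ge0// ler_pM.
by move: le1; lra.
Qed.

(** The value of [g - 1] at a root [u] is at most [(1/3) / (1 - 1/2) < 1],
    hence [g u] is nonzero and all [m] roots come from [b]. *)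
Lemma has_zeros_normalized : has_zeros m b 1.
Proof.
have bB : coef_bd 1 1 b.
  move=> n; rewrite expr1n mulr1; have [->|nm] := eqVneq n m; first by rewrite bm nrm1.
  apply: (@le_trans _ _ (1 / 4)); last lra.
  apply: le_trans (b_off n.+1).
  rewrite (bigD1 ord_max)//= lerDl sumr_ge0// => i _; exact: nrm_ge0.
have gG : coef_bd 1 (4 / 3) neumann_sol.
  by move=> n; rewrite expr1n mulr1 neumann_sol_le.
have [rs ers] := closed_field_poly_normal neumann_poly.
have lc1 : lead_coef neumann_poly = 1.
  by rewrite lead_coefE size_neumann_poly coef_neumann_poly lead_neumann_poly.
rewrite lc1 scale1r in ers.
have <- : size rs = m.
  by apply: succn_inj; rewrite -size_neumann_poly ers size_prod_XsubC.
apply: (has_zeros_of_cauchy_prod bB gG) => [u urs|n]; last first.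
  by rewrite -ers coef_neumann_poly.
have u2 : nrm u <= 1 / 2.
  by apply: root_neumann_poly; rewrite ers root_prod_XsubC.
split => //; have half1 : 1 / 2 < 1 :> R by lra.
have u1 := le_lt_trans u2 half1.
have gB : coef_bd 1 (1 / 3) (fun n => neumann_sol n - ps_const 1 n).
  by move=> n; rewrite expr1n mulr1 neumann_sol_near.
have dB : coef_bd 1 1 (ps_const 1 : nat -> Cplx R).
  by move=> n; rewrite expr1n mulr1 /ps_const; case: ifP; rewrite ?nrm1 ?nrm0.
have := ps_val_le ltr01 gB u2 half1; rewrite (_ : 1 - 1 / 2 = 1 / 2); last lra.
rewrite (ps_valB ltr01 gG dB u1) (ps_cvg_const _ _).2.
apply: contraTneq => ->; rewrite sub0r nrmN nrm1 -ltNge; lra.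
Qed.

End neumann.

Lemma has_zeros_scale m b c B (rho lam : Cplx R) : rho != 0 -> coef_bd 1 B b ->
  (forall n, c n = lam / rho ^+ n * b n) -> has_zeros m b 1 ->
  has_zeros m c (nrm rho).
Proof.
move=> rho0; elim: m b c B lam => // m IH b c B lam bB cb /= [w [w1 bw dz]].
have r0 : 0 < nrm rho by rewrite lt_neqAle nrm_ge0 eq_sym nrm_eq0 rho0.
have evc n : ps_val (ps_tail c n) (rho * w) = lam / rho ^+ n * ps_val (ps_tail b n) w.
  have [_ <-] := ps_cvgZ (lam / rho ^+ n) (coef_bd_cvg ltr01 (coef_bd_tail n ltr01 bB) w1).
  rewrite /ps_val; congr (limn (series _)); apply/funext => k.
  rewrite /ps_tail cb exprMn exprD; field.
  by rewrite !expf_neq0.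
exists (rho * w); split.
- by rewrite nrmM gtr_pMr.
- rewrite -[ps_val c _]/(ps_val (ps_tail c 0) _) evc.
  by rewrite -[ps_val (ps_tail b 0) w]/(ps_val b w) bw mulr0.
apply: (IH _ _ _ (lam / rho) (coef_bd_div_linear ltr01 bB (lexx _) w1)) => // n.
by rewrite /div_linear evc exprS invfM mulrA.
Qed.

(** Rouche's theorem with a strong form of domination: the lower terms are
    exponentially small compared with the term of degree [m], so that the
    zeros lie well inside the disk. *)
Lemma dominant_has_zeros c m r : 0 < r -> c m != 0 ->
  (forall i, (i < m)%N ->
    nrm (c i) * r ^+ i <= (4 * 8 ^+ m)^-1 * (nrm (c m) * r ^+ m)) ->
  (forall N, \sum_(i < N | (m < i)%N) nrm (c i) * r ^+ i <=
    1 / 8 * (nrm (c m) * r ^+ m)) ->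
  has_zeros m c r.
Proof.
move=> r0 cm low high.
pose rho := real_cplx r.
have nrho : nrm rho = r by rewrite nrm_real ger0_norm// ltW.
have rho0 : rho != 0 by rewrite -nrm_eq0 nrho gt_eqF.
pose b n := c n * rho ^+ n / (c m * rho ^+ m).
have M0 : 0 < nrm (c m) * r ^+ m.
  by rewrite mulr_gt0 ?exprn_gt0// lt_neqAle nrm_ge0 eq_sym nrm_eq0 cm.
have nb n : nrm (b n) = nrm (c n) * r ^+ n / (nrm (c m) * r ^+ m).
  by rewrite !(nrmM, nrmV, nrmX) nrho.
have bm : b m = 1 by rewrite /b divff// mulf_neq0// expf_neq0.
have b_low i : (i < m)%N -> nrm (b i) <= (4 * 8 ^+ m)^-1.
  by move=> im; rewrite nb ler_pdivrMr// low.
have p8 : 0 < 8 ^+ m :> R by rewrite exprn_gt0.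
have b_off N : \sum_(i < N | i != m :> nat) nrm (b i) <= 1 / 4.
  rewrite (bigID (fun i : 'I_N => i < m)%N)/=.
  rewrite (_ : 1 / 4 = 1 / 8 + 1 / 8 :> R); last lra.
  apply: lerD.
    apply: (@le_trans _ _ (\sum_(i < N | (i < m)%N) (4 * 8 ^+ m)^-1)).
      rewrite (eq_bigl (fun i : 'I_N => (i < m)%N)); last first.
        by move=> i /=; case: ltnP; rewrite ?andbF// andbT => /ltn_eqF ->.
      by apply: ler_sum => i; exact: b_low.
    have x0 : 0 <= (4 * 8 ^+ m)^-1 :> R by rewrite invr_ge0 mulr_ge0// ltW.
    apply: (@le_trans _ _ (m%:R * (4 * 8 ^+ m)^-1)).
      have [mN|Nm] := leqP m N.
        rewrite -(big_ord_widen N (fun=> (4 * 8 ^+ m)^-1) mN).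
        by rewrite sumr_const card_ord -[leLHS]mulr_natl.
      rewrite (eq_bigl xpredT) => [|i]; last by rewrite (ltn_trans _ Nm).
      by rewrite sumr_const card_ord -[leLHS]mulr_natl ler_wpM2r// ler_nat ltnW.
    rewrite ler_pdivrMr ?mulr_gt0//.
    have : (2 * m <= 8 ^ m)%N.
      case: (m) => // k; rewrite (@leq_trans (2 * 4 ^ k.+1))//.
        by rewrite leq_mul2l/= ltnW// ltn_expl.
      by rewrite -[8%N]/(2 * 4)%N expnMn leq_mul2r [(2 ^ _)%N]expnS leq_pmulr ?expn_gt0 ?orbT.
    by rewrite -(ler_nat R) natrM natrX; lra.
  apply: le_trans (_ : \sum_(i < N | (m < i)%N) nrm (b i) <= _).
    rewrite le_eqVlt; apply/orP; left; apply/eqP; apply: eq_bigl => i.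
    by rewrite -leqNgt ltn_neqAle eq_sym.
  under eq_bigr do rewrite nb.
  by rewrite -mulr_suml ler_pdivrMr.
have bB : coef_bd 1 1 b.
  move=> n; rewrite expr1n mulr1; have [->|nm] := eqVneq n m; first by rewrite bm nrm1.
  apply: (@le_trans _ _ (1 / 4)); last lra.
  apply: le_trans (b_off n.+1).
  rewrite (bigD1 ord_max)//= lerDl sumr_ge0// => i _; exact: nrm_ge0.
rewrite -nrho.
apply: (has_zeros_scale (lam := c m * rho ^+ m) rho0 bB).
  by move=> n; rewrite /b; field; rewrite cm !expf_neq0.
exact: has_zeros_normalized.
Qed.

End weierstrass_preparation.

(** * Measurability of the number of zeros *)
Section measurability.
Context {R : realType} {d : measure_display} {T : measurableType d}.
Implicit Types (f g : T -> Cplx R).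

Definition mcplx f :=
  measurable_fun setT (fun x => complex.Re (f x)) /\
  measurable_fun setT (fun x => complex.Im (f x)).

Lemma mcplx_cst (z : Cplx R) : mcplx (fun=> z).
Proof. by split; exact: measurable_cst. Qed.

Lemma mcplxD f g : mcplx f -> mcplx g -> mcplx (fun x => f x + g x).
Proof.
move=> [f1 f2] [g1 g2]; split.
  by under eq_fun do rewrite ReD; exact: measurable_funD.
by under eq_fun do rewrite ImD; exact: measurable_funD.
Qed.

Lemma ReM (z w : Cplx R) : complex.Re (z * w) =
  complex.Re z * complex.Re w - complex.Im z * complex.Im w.
Proof. by case: z w => ? ? [? ?]. Qed.

Lemma ImM (z w : Cplx R) : complex.Im (z * w) =
  complex.Re z * complex.Im w + complex.Im z * complex.Re w.
Proof. by case: z w => ? ? [? ?]. Qed.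

Lemma mcplxM f g : mcplx f -> mcplx g -> mcplx (fun x => f x * g x).
Proof.
move=> [f1 f2] [g1 g2]; split.
  by under eq_fun do rewrite ReM; apply: measurable_funB; exact: measurable_funM.
by under eq_fun do rewrite ImM; apply: measurable_funD; exact: measurable_funM.
Qed.

Lemma mcplx_sum (I : Type) (l : seq I) (f : I -> T -> Cplx R) :
  (forall i, mcplx (f i)) -> mcplx (fun x => \sum_(i <- l) f i x).
Proof.
move=> mf; elim: l => [|i l IH].
  by under eq_fun do rewrite big_nil; exact: mcplx_cst.
by under eq_fun do rewrite big_cons; exact: mcplxD.
Qed.

Lemma mcplx_cvg (u : nat -> T -> Cplx R) f : (forall n, mcplx (u n)) ->
  (forall x, (fun n => u n x) @ \oo --> f x) -> mcplx f.
Proof.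
move=> mu uf; split.
  apply: (measurable_fun_cvg (h := fun n x => complex.Re (u n x))).
    by move=> n; exact: (mu n).1.
  by move=> x _; exact: (proj1 (cvg_ReIm _ _) (uf x)).1.
apply: (measurable_fun_cvg (h := fun n x => complex.Im (u n x))).
  by move=> n; exact: (mu n).2.
by move=> x _; exact: (proj1 (cvg_ReIm _ _) (uf x)).2.
Qed.

Lemma measurable_nrm f : mcplx f -> measurable_fun setT (fun x => nrm (f x)).
Proof.
move=> [f1 f2].
have -> : (fun x => nrm (f x)) = (@Num.sqrt R) \o
    (fun x => complex.Re (f x) ^+ 2 + complex.Im (f x) ^+ 2).
  by apply/funext => x /=; case: (f x).
apply: measurableT_comp.
  by apply: continuous_measurable_fun; exact: sqrt_continuous.
by apply: measurable_funD; exact: measurable_funX.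
Qed.

Lemma measurable_le (h k : T -> R) : measurable_fun setT h ->
  measurable_fun setT k -> measurable [set x | h x <= k x].
Proof.
move=> mh mk; have := measurable_fun_ler mh mk measurableT (_ : measurable [set true]).
rewrite setTI => /(_ _); rewrite (_ : _ @^-1` _ = [set x | h x <= k x]); last first.
  by apply/seteqP; split.
by apply.
Qed.

Lemma measurable_nrm_le f (x : R) : mcplx f -> measurable [set w | nrm (f w) <= x].
Proof. by move=> mf; apply: measurable_le; [exact: measurable_nrm|exact: measurable_cst]. Qed.

Lemma mcplx_ps_val (c : T -> nat -> Cplx R) (z : Cplx R) :
  (forall w, entire (c w)) -> (forall n, mcplx (fun w => c w n)) ->
  mcplx (fun w => ps_val (c w) z).
Proof.
move=> ce mc.
apply: (mcplx_cvg (u := fun N w => series (fun n => c w n * z ^+ n) N)).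
  move=> N; under eq_fun do rewrite seriesEnat /=.
  by apply: mcplx_sum => n; apply: mcplxM => //; exact: mcplx_cst.
by move=> w; exact: entire_ps_cvg (ce w).
Qed.

Lemma entire_tail (c : nat -> Cplx R) k : entire c -> entire (ps_tail c k).
Proof.
by move=> ce s s0; have [A cA] := ce s s0; exists (A / s ^+ k); exact: coef_bd_tail.
Qed.

Lemma mcplx_div_linears (c : T -> nat -> Cplx R) (zs : nat -> Cplx R) j :
  (forall w, entire (c w)) -> (forall n, mcplx (fun w => c w n)) ->
  (forall w, entire (div_linears (c w) zs j)) /\
  (forall n, mcplx (fun w => div_linears (c w) zs j n)).
Proof.
move=> ce mc; elim: j => //= j [IH1 IH2]; split.
  by move=> w; exact: entire_div_linear.
move=> n; rewrite /div_linear; apply: mcplx_ps_val => [w|k]; first exact: entire_tail.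
exact: IH2.
Qed.

(** The sets in the countable criterion are measurable because the successive
    quotients at fixed points are pointwise limits of polynomials in the
    coefficients. *)
Lemma measurable_has_zeros (c : T -> nat -> Cplx R) m (r : R) : 0 < r ->
  (forall w, entire (c w)) -> (forall n, mcplx (fun w => c w n)) ->
  measurable [set w | has_zeros m (c w) r].
Proof.
move=> r0 ce mc.
pose good p k (q : seq (rat * rat)) := \bigcap_(j in [set j | (j < m)%N])
  [set w | nrm (rat_pts q j : Cplx R) <= inner_radius r p /\
    nrm (ps_val (div_linears (c w) (rat_pts q) j) (rat_pts q j)) <= k.+1%:R^-1].
(* lists of rational points are enumerated by integers, to form a countable
   union *)
have [dec decP] : exists dec : nat -> option (seq (rat * rat)),
    forall q, exists i, dec i = Some q.
  by exists unpickle => q; exists (pickle q); exact: pickleK.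
have -> : [set w | has_zeros m (c w) r] =
    \bigcup_p \bigcap_k \bigcup_i
      (if dec i is Some q then good p k q else set0).
  apply/seteqP; split => w /=.
    move/(has_zeros_approx _ r0 (ce w)) => [p h]; exists p => // k _.
    have [q hq] := h k; have [i qi] := decP q.
    by exists i => //; rewrite qi => j jm; exact: hq.
  move=> [p _ h]; apply/(has_zeros_approx _ r0 (ce w)); exists p => k.
  have [i _] := h k I; case: (dec i) => // q hq; exists q => j jm.
  exact: hq.
apply: bigcup_measurable => p _; apply: bigcapT_measurable => k.
apply: bigcup_measurable => i _; case: (dec i) => // q.
have [/eqP m0|] := boolP (m == 0)%N.
  by rewrite /good m0 (_ : [set j | _] = set0) ?bigcap_set0//; apply/seteqP; split.
rewrite -lt0n => m0.
apply: bigcap_measurable => [|j /= _]; first by exists 0%N.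
have [h|h] := boolP (nrm (rat_pts q j : Cplx R) <= inner_radius r p); last first.
  rewrite (_ : [set _ | _] = set0)//.
  by apply/seteqP; split => w //= -[].
rewrite (_ : [set _ | _] = [set w |
   nrm (ps_val (div_linears (c w) (rat_pts q) j) (rat_pts q j)) <= k.+1%:R^-1]); last first.
  by apply/seteqP; split => w //= -[].
have [h1 h2] := mcplx_div_linears (rat_pts q) j ce mc.
by apply: measurable_nrm_le; exact: mcplx_ps_val.
Qed.

Definition gaf_coef (a : nat -> T -> Cplx R) (w : T) (n : nat) : Cplx R :=
  a n w / real_cplx (Num.sqrt (n`!%:R)).

Lemma gaf_partial_sumsE a w z : gaf_partial_sums (a ^~ w) z =
  series (fun n => gaf_coef a w n * z ^+ n).
Proof. by congr series; apply/funext => n; rewrite /gaf_coef mulrAC. Qed.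

(** Terms of a series converging at the real point [s] are bounded, which is
    the growth bound at radius [s]. *)
Lemma entire_cvgP (c : nat -> Cplx R) : (forall z, ps_cvg c z) <-> entire c.
Proof.
split=> [h s s0|ce z]; last exact: entire_ps_cvg.
have /cvg_series_cvg_0 := h (real_cplx s).
move=> /(cvg_nrm _ _)/cvgrPdist_lt/(_ 1 ltr01)[N _ hN].
exists (1 + \sum_(i < N) nrm (c i) * s ^+ i) => n.
have [nN|Nn] := ltnP n N.
  rewrite (bigD1 (Ordinal nN))//= addrCA lerDl addr_ge0// sumr_ge0// => i _.
  by rewrite mulr_ge0 ?nrm_ge0// exprn_ge0// ltW.
have := hN n Nn; rewrite /= sub0r normrN subr0 ger0_norm ?nrm_ge0//.
rewrite nrmM nrmX nrm_real (ger0_norm (ltW s0)) => /ltW/le_trans; apply.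
rewrite lerDl sumr_ge0// => i _.
by rewrite mulr_ge0 ?nrm_ge0// exprn_ge0// ltW.
Qed.

(** Coefficients of the sample function: setting them to zero on the event of
    divergence reproduces the convention of [planar_gaf], and makes all sample
    sequences entire. *)
Definition sample_coef (a : nat -> T -> Cplx R) (w : T) : nat -> Cplx R :=
  if `[< entire (gaf_coef a w) >] then gaf_coef a w else fun=> 0.

Lemma entire0 : entire (fun=> 0 : Cplx R).
Proof. by move=> s s0; exists 0 => n; rewrite nrm0 mul0r. Qed.

Lemma entire_sample_coef a w : entire (sample_coef a w).
Proof.
rewrite /sample_coef; case: asboolP => // _; exact: entire0.
Qed.

Lemma planar_gafE a w : planar_gaf a w = ps_val (sample_coef a w).
Proof.
rewrite /planar_gaf /sample_coef.
have -> : `[< forall z, cvgn (gaf_partial_sums (a ^~ w) z) >] =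
    `[< entire (gaf_coef a w) >].
  apply: asbool_equiv_eq; rewrite -entire_cvgP.
  by split=> h z; have := h z; rewrite gaf_partial_sumsE.
case: asboolP => _; apply/funext => z; last by rewrite ps_val0.
by rewrite gaf_partial_sumsE.
Qed.

Lemma mcplx_plane_of (X : T -> Cplx R) :
  measurable_fun [set: T] (plane_of \o X) -> mcplx X.
Proof.
move=> mX; split.
  exact: (measurableT_comp (measurable_fst) mX).
exact: (measurableT_comp (measurable_snd) mX).
Qed.

Lemma mcplx_gaf_coef a n : (forall n, mcplx (a n)) ->
  mcplx (fun w => gaf_coef a w n).
Proof. by move=> ma; apply: mcplxM => //; exact: mcplx_cst. Qed.

(** Integer radii and integer bounds suffice, so the event is a countable
    combination of conditions on single coefficients. *)
Lemma measurable_entire a : (forall n, mcplx (a n)) ->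
  measurable [set w | entire (gaf_coef a w)].
Proof.
move=> ma.
rewrite (_ : [set _ | _] = \bigcap_k \bigcup_A \bigcap_n
  [set w | nrm (gaf_coef a w n) <= A%:R / k.+1%:R ^+ n]).
  apply: bigcapT_measurable => k; apply: bigcup_measurable => A _.
  apply: bigcapT_measurable => n; apply: measurable_nrm_le.
  exact: mcplx_gaf_coef.
have e (x : R) (A k n : nat) :
    (x <= A%:R / k.+1%:R ^+ n) = (x * k.+1%:R ^+ n <= A%:R).
  by rewrite ler_pdivlMr// exprn_gt0.
apply/seteqP; split => w /=.
  move=> h k _; have [|A hA] := h k.+1%:R; first by rewrite ltr0n.
  exists (Num.bound A) => // n _ /=; rewrite e (le_trans (hA n))// ltW//.
  by rewrite archi_boundP// (coef_bd_ge0 hA).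
move=> h s s0; have [A _ hA] := h (Num.bound s) I.
exists A%:R; apply: (@coef_bd_shrink _ (Num.bound s).+1%:R); first exact: ltW.
  by rewrite ltW// (lt_trans (archi_boundP (ltW s0)))// ltr_nat.
by move=> n; rewrite -e; exact: hA.
Qed.

Lemma mcplx_sample_coef a n : (forall n, mcplx (a n)) ->
  mcplx (fun w => sample_coef a w n).
Proof.
move=> ma; pose E := [set w | entire (gaf_coef a w)].
rewrite (_ : (fun _ => _) = fun w => real_cplx (\1_E w) * gaf_coef a w n).
  apply: mcplxM; last exact: mcplx_gaf_coef.
  split; last exact: measurable_cst.
  by apply: measurable_indic; exact: measurable_entire.
apply/funext => w; rewrite /sample_coef indicE; case: asboolP => h.
  by rewrite mem_set//= -[real_cplx _]/(1 : Cplx R) mul1r.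
by rewrite memNset//= -[real_cplx _]/(0 : Cplx R) mul0r.
Qed.

Lemma overcrowdedE a m (r : R) :
  [set w | (m%:R%:E <= num_zeros (planar_gaf a w) r)%E] =
  [set w | has_zeros m (sample_coef a w) r].
Proof.
apply/funext => w; apply/propext; rewrite /= planar_gafE.
exact: num_zerosP (entire_sample_coef a w).
Qed.

Lemma measurable_overcrowded a m (r : R) : 0 < r -> (forall n, mcplx (a n)) ->
  measurable [set w | (m%:R%:E <= num_zeros (planar_gaf a w) r)%E].
Proof.
move=> r0 ma; rewrite overcrowdedE; apply: measurable_has_zeros => //.
  by move=> w; exact: entire_sample_coef.
by move=> n; exact: mcplx_sample_coef.
Qed.

End measurability.

(** * Disks and tails for one complex Gaussian *)
Section gaussian_estimates.
Context {R : realType} {d : measure_display} {T : measurableType d}.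
Variables (P : probability T R) (X : T -> Cplx R).
Hypothesis X_normal : std_complex_normal P X.

Local Notation plane := (measurableTypeR R * measurableTypeR R)%type.
Local Notation mu2 := (@lebesgue_measure R \x @lebesgue_measure R)%E.

Definition gauss_density (p : plane) : R :=
  pi^-1 * expR (- (p.1 ^+ 2 + p.2 ^+ 2)).

Lemma measurable_sqr_norm :
  measurable_fun setT (fun p : plane => p.1 ^+ 2 + p.2 ^+ 2 : R).
Proof.
apply: measurable_funD; apply: measurable_funX.
  exact: measurable_fst.
exact: measurable_snd.
Qed.

Lemma measurable_expR_sqr_norm (k : R) :
  measurable_fun setT (fun p : plane => expR (- (k * (p.1 ^+ 2 + p.2 ^+ 2))) : R).
Proof.
apply: measurableT_comp; first exact: measurable_expR.
apply: measurable_funN; apply: measurable_funM; first exact: measurable_cst.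
exact: measurable_sqr_norm.
Qed.

Lemma measurable_gauss_density : measurable_fun setT gauss_density.
Proof.
apply: measurable_funM; first exact: measurable_cst.
by under eq_fun do rewrite -[X in - X]mul1r; exact: measurable_expR_sqr_norm.
Qed.

Lemma gauss_density_ge0 p : 0 <= gauss_density p.
Proof. by rewrite mulr_ge0 ?expR_ge0// invr_ge0 pi_ge0. Qed.

Definition square (u v : R) : set plane := `[u, v]%classic `*` `[u, v]%classic.

Lemma measurable_square u v : measurable (square u v).
Proof. by apply: measurableX; exact: measurable_itv. Qed.

Lemma square_measure u v : u <= v -> mu2 (square u v) = ((v - u) ^+ 2)%:E.
Proof.
move=> uv.
have itvE : lebesgue_measure (`[u, v]%classic : set R) = (v - u)%:E.
  rewrite lebesgue_measure_itv /= lte_fin.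
  by move: uv; rewrite le_eqVlt => /orP[/eqP ->|->]; rewrite ?ltxx ?subrr.
rewrite expr2 EFinM -itvE; apply: product_measure1E; exact: measurable_itv.
Qed.

Lemma prob_square_le u v : u <= v ->
  (P ((plane_of \o X) @^-1` square u v) <= (pi^-1 * (v - u) ^+ 2)%:E)%E.
Proof.
move=> uv; have mQ := measurable_square u v.
rewrite (X_normal.2 _ mQ).
apply: (@le_trans _ _ (\int[mu2]_(p in square u v) (cst (pi^-1)%:E p))%E).
  apply: ge0_le_integral => //.
  - by move=> p _; rewrite lee_fin gauss_density_ge0.
  - apply: measurable_funTS; apply/measurable_EFinP.
    exact: measurable_gauss_density.
  - move=> p _; rewrite lee_fin ler_piMr ?invr_ge0 ?pi_ge0//.
    by rewrite -[leRHS]expR0 ler_expR oppr_le0 addr_ge0 ?sqr_ge0.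
by rewrite integral_cst// EFinM -(square_measure uv).
Qed.

Lemma prob_square_ge u v (k : R) : u <= v -> 0 <= k ->
  (forall x, u <= x <= v -> x ^+ 2 <= k) ->
  ((pi^-1 * expR (- (k + k)) * (v - u) ^+ 2)%:E <=
   P ((plane_of \o X) @^-1` square u v))%E.
Proof.
move=> uv k0 xk; have mQ := measurable_square u v.
rewrite (X_normal.2 _ mQ).
apply: (@le_trans _ _ (\int[mu2]_(p in square u v)
    (cst (pi^-1 * expR (- (k + k)))%:E p))%E).
  by rewrite integral_cst// EFinM -(square_measure uv).
apply: ge0_le_integral => //.
- by move=> p _; rewrite lee_fin mulr_ge0 ?expR_ge0// invr_ge0 pi_ge0.
- apply: measurable_funTS; apply/measurable_EFinP.
  exact: measurable_gauss_density.
- move=> p [/= p1 p2]; rewrite lee_fin ler_wpM2l ?invr_ge0 ?pi_ge0//.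
  by rewrite ler_expR lerN2 lerD// xk.
Qed.

Lemma mcplx_normal : mcplx X.
Proof. exact/mcplx_plane_of/X_normal.1. Qed.

Lemma measurable_disk (x : R) : measurable [set w | nrm (X w) <= x].
Proof. exact: measurable_nrm_le mcplx_normal. Qed.

Lemma measurable_codisk (x : R) : measurable [set w | x <= nrm (X w)].
Proof.
apply: measurable_le; [exact: measurable_cst|exact: measurable_nrm mcplx_normal].
Qed.

Lemma nrm_plane w : nrm (X w) = Num.sqrt ((plane_of (X w)).1 ^+ 2 + (plane_of (X w)).2 ^+ 2).
Proof. by rewrite /plane_of /=; case: (X w). Qed.

Lemma measurable_preim (A : set plane) : measurable A ->
  measurable ((plane_of \o X) @^-1` A).
Proof. by move=> mA; have := X_normal.1 measurableT A mA; rewrite setTI. Qed.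

(** The disk of radius [x] sits inside a square of area [4 x^2], and the density
    is at most [1 / pi <= 1 / 2]. *)
Lemma prob_disk_le x : 0 <= x ->
  (P [set w | (nrm (X w) <= x)%R] <= (2 * x ^+ 2)%:E)%E.
Proof.
move=> x0; have xx : - x <= x by lra.
apply: (@le_trans _ _ (P ((plane_of \o X) @^-1` square (- x) x))).
  apply: le_measure; rewrite ?inE; first exact: measurable_disk.
    by apply: measurable_preim; exact: measurable_square.
  move=> w /= wx; split; rewrite /= in_itv /= -ler_norml.
    exact: le_trans (Re_nrm _) wx.
  exact: le_trans (Im_nrm _) wx.
apply: le_trans (prob_square_le xx) _; rewrite lee_fin.
rewrite opprK (_ : (x + x) ^+ 2 = 4 * x ^+ 2); last by ring.
rewrite mulrA ler_wpM2r ?sqr_ge0// ler_pdivrMl ?pi_gt0//.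
have := pi_ge2 R; lra.
Qed.

(** The disk of radius [x] contains the square of side [x], on which the
    density is at least [e^(-2) / pi]. *)
Lemma prob_disk_ge x : 0 <= x <= 1 ->
  ((pi^-1 * expR (- 2) * x ^+ 2)%:E <= P [set w | (nrm (X w) <= x)%R])%E.
Proof.
move=> /andP[x0 x1]; have xx : - (x / 2) <= x / 2 by lra.
have h y : - (x / 2) <= y <= x / 2 -> y ^+ 2 <= 1.
  by move=> /andP[y1 y2]; rewrite -[y ^+ 2]real_normK ?num_real// expr_le1// ler_norml; lra.
have := prob_square_ge xx ler01 h.
rewrite (_ : x / 2 - - (x / 2) = x); last by field.
rewrite -[1 + 1]/(2 : R) => /le_trans; apply.
apply: le_measure; rewrite ?inE; last 1 first.
- move=> w [/=]; rewrite !in_itv /= -!ler_norml => h1 h2.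
  rewrite (le_trans (nrm_ReIm _))// [leRHS](_ : _ = x / 2 + x / 2); last by field.
  exact: lerD.
- by apply: measurable_preim; exact: measurable_square.
- exact: measurable_disk.
Qed.

(** A unit square with lower left corner [(x, x)] lies outside the disk. *)
Lemma prob_codisk_ge x : 0 <= x ->
  ((pi^-1 * expR (- ((x + 1) ^+ 2 + (x + 1) ^+ 2)))%:E <=
   P [set w | (x <= nrm (X w))%R])%E.
Proof.
move=> x0; have xx : x <= x + 1 by lra.
have h y : x <= y <= x + 1 -> y ^+ 2 <= (x + 1) ^+ 2.
  by move=> /andP[y1 y2]; rewrite lerXn2r ?nnegrE//; lra.
have := prob_square_ge xx (sqr_ge0 _) h.
rewrite (_ : x + 1 - x = 1) ?expr1n ?mulr1; last lra.
move=> /le_trans; apply.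
apply: le_measure; rewrite ?inE; last 1 first.
- move=> w [/=]; rewrite !in_itv /= => /andP[h1 _] _.
  by rewrite (le_trans h1)// (le_trans (ler_norm _))// Re_nrm.
- by apply: measurable_preim; exact: measurable_square.
- exact: measurable_codisk.
Qed.

(** The integrand is twice a product of two standard normal densities. *)
Lemma gauss_plane_mass :
  (\int[mu2]_p (pi^-1 * expR (- (2^-1 * (p.1 ^+ 2 + p.2 ^+ 2))))%:E = 2%:E)%E.
Proof.
have pdfE (x : R) : normal_pdf 0 1 x =
    (Num.sqrt (pi *+ 2))^-1 * expR (- (x ^+ 2 / 2)).
  rewrite normal_pdfE ?oner_neq0// /normal_peak /normal_fun.
  by rewrite subr0 expr1n mul1r mulNr.
have e p : pi^-1 * expR (- (2^-1 * (p.1 ^+ 2 + p.2 ^+ 2))) =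
    2 * (normal_pdf 0 1 p.1 * normal_pdf 0 1 p.2) :> R.
  rewrite !pdfE mulrACA -expRD -invfM -expr2 sqr_sqrtr; last first.
    by apply: mulrn_wge0; exact: pi_ge0.
  rewrite mulrA; congr (_ * expR _); last by field.
  by rewrite -[pi *+ 2]mulr_natl invfM mulrA divff// mul1r.
have pdf0 (x : R) : 0 <= normal_pdf 0 1 x by exact: normal_pdf_ge0.
have mpdf : measurable_fun setT (fun x : measurableTypeR R => (normal_pdf 0 1 x)%:E).
  by apply/measurable_EFinP; exact: measurable_normal_pdf.
under eq_integral do rewrite e.
rewrite fubini_tonelli1; last 2 first.
- apply/measurable_EFinP; apply: measurable_funM; first exact: measurable_cst.
  apply: measurable_funM; apply: (measurableT_comp (@measurable_normal_pdf R 0 1)).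
    exact: measurable_fst.
  exact: measurable_snd.
- by move=> p; rewrite lee_fin !mulr_ge0.
rewrite /fubini_F /=.
under eq_integral => x _.
  under eq_integral => y _ do rewrite mulrA EFinM.
  rewrite ge0_integralZl//; last 2 first.
  - by move=> y _; rewrite lee_fin.
  - by rewrite lee_fin mulr_ge0.
  rewrite integral_normal_pdf mule1 EFinM.
  over.
rewrite ge0_integralZl//; last by move=> y _; rewrite lee_fin.
by rewrite integral_normal_pdf mule1.
Qed.

(** Where [|z| >= x], half of the exponent is bounded by [- x^2 / 2] and the
    other half is integrated over the whole plane. *)
Lemma prob_tail_le x : 0 <= x ->
  (P [set w | (x < nrm (X w))%R] <= (2 * expR (- (x ^+ 2 / 2)))%:E)%E.
Proof.
move=> x0.
pose S : set plane := [set p | x ^+ 2 <= p.1 ^+ 2 + p.2 ^+ 2].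
have mS : measurable S.
  apply: measurable_le; [exact: measurable_cst|exact: measurable_sqr_norm].
have SE : [set w | (x < nrm (X w))%R] `<=` (plane_of \o X) @^-1` S.
  move=> w /= xw; rewrite /S /=.
  have := ltW xw; rewrite nrm_plane -[x in x <= _]ger0_norm// -sqrtr_sqr.
  by rewrite ler_psqrt// ?nnegrE ?sqr_ge0// addr_ge0 ?sqr_ge0.
apply: (@le_trans _ _ (P ((plane_of \o X) @^-1` S))).
  apply: le_measure SE; rewrite inE; last exact: measurable_preim.
  rewrite (_ : [set _ | _] = ~` [set w | nrm (X w) <= x]).
    by apply: measurableC; exact: measurable_disk.
  by apply/seteqP; split => w /=; rewrite ltNge => /negP.
rewrite (X_normal.2 _ mS).
have mf := measurable_expR_sqr_norm 2^-1.
have mg : measurable_fun setT (fun p : plane =>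
    (pi^-1 * expR (- (2^-1 * (p.1 ^+ 2 + p.2 ^+ 2))))%:E).
  by apply/measurable_EFinP; apply: measurable_funM => //; exact: measurable_cst.
have g0 (p : plane) : (0 <= (pi^-1 * expR (- (2^-1 * (p.1 ^+ 2 + p.2 ^+ 2))))%:E)%E.
  by rewrite lee_fin mulr_ge0 ?expR_ge0// invr_ge0 pi_ge0.
rewrite mulrC EFinM -gauss_plane_mass -ge0_integralZl//.
apply: (@le_trans _ _ (\int[mu2]_(p in S) ((expR (- (x ^+ 2 / 2)))%:E *
    (pi^-1 * expR (- (2^-1 * (p.1 ^+ 2 + p.2 ^+ 2))))%:E))%E); last first.
  apply: ge0_subset_integral => //; first exact: measurable_funeM.
  by move=> p _; rewrite mule_ge0// lee_fin expR_ge0.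
apply: ge0_le_integral => //.
- by move=> p _; rewrite lee_fin gauss_density_ge0.
- apply: measurable_funTS; apply/measurable_EFinP.
  exact: measurable_gauss_density.
- by apply: measurable_funTS; exact: measurable_funeM.
- move=> p Sp; rewrite -EFinM lee_fin mulrCA ler_wpM2l ?invr_ge0 ?pi_ge0//.
  rewrite -expRD ler_expR; move: Sp; rewrite /S /=; lra.
Qed.

End gaussian_estimates.

(** * Growth of the coefficients; independence of their moduli *)
Section gaf_growth.
Context {R : realType} {d : measure_display} {T : measurableType d}.

(** Square root of [y^n / n! <= e^y] at [y = 4 s^2]. *)
Lemma sqrt_fact_ratio_le (s : R) n : 0 <= s ->
  (2 * s) ^+ n / Num.sqrt (n`!%:R) <= expR (2 * s ^+ 2).
Proof.
move=> s0; have f0 : 0 < n`!%:R :> R by rewrite ltr0n fact_gt0.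
have -> : (2 * s) ^+ n / Num.sqrt (n`!%:R) =
    Num.sqrt ((4 * s ^+ 2) ^+ n / n`!%:R).
  rewrite sqrtrM ?exprn_ge0 ?mulr_ge0 ?sqr_ge0// sqrtrV ?ltW//.
  rewrite (_ : 4 * s ^+ 2 = (2 * s) ^+ 2); last by ring.
  by rewrite exprAC sqrtr_sqr ger0_norm// exprn_ge0// mulr_ge0.
have -> : expR (2 * s ^+ 2) = Num.sqrt (expR (4 * s ^+ 2)) :> R.
  rewrite (_ : 4 * s ^+ 2 = 2 * s ^+ 2 + 2 * s ^+ 2); last by ring.
  by rewrite expRD -expr2 sqrtr_sqr ger0_norm// expR_ge0.
have x0 : 0 <= 4 * s ^+ 2 by rewrite mulr_ge0// sqr_ge0.
rewrite ler_wsqrtr//; case: n f0 => [|n] f0.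
  by rewrite expr0 fact0 divr1 (le_trans _ (expR_ge1Dx _))// lerDl.
by apply: le_trans (expR_ge1Dxn n x0); rewrite lerDr.
Qed.

Lemma gaf_coef_bd (a : nat -> T -> Cplx R) w (M s : R) : 0 < s ->
  (forall n, nrm (a n w) <= M * 2 ^+ n) ->
  coef_bd s (M * expR (2 * s ^+ 2)) (gaf_coef a w).
Proof.
move=> s0 aM n.
have M0 : 0 <= M by have := aM 0%N; rewrite expr0 mulr1; apply: le_trans; exact: nrm_ge0.
rewrite /gaf_coef nrmM nrmV nrm_real ger0_norm ?sqrtr_ge0//.
rewrite mulrAC.
have h := sqrt_fact_ratio_le n (ltW s0).
apply: le_trans (ler_wpM2l M0 h).
rewrite exprMn !mulrA ler_wpM2r ?invr_ge0 ?sqrtr_ge0// ler_wpM2r//.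
by rewrite exprn_ge0// ltW.
Qed.

Lemma gaf_coef_entire (a : nat -> T -> Cplx R) w (M : R) :
  (forall n, nrm (a n w) <= M * 2 ^+ n) -> entire (gaf_coef a w).
Proof. by move=> aM s s0; exists (M * expR (2 * s ^+ 2)); exact: gaf_coef_bd. Qed.

Lemma nrm_gaf_coef (a : nat -> T -> Cplx R) w n :
  nrm (a n w) = Num.sqrt (n`!%:R) * nrm (gaf_coef a w n).
Proof.
rewrite /gaf_coef nrmM nrmV nrm_real ger0_norm ?sqrtr_ge0//.
by rewrite mulrC divfK// sqrtr_eq0 -ltNge ltr0n fact_gt0.
Qed.

End gaf_growth.

Section independence.
Context {R : realType} {d : measure_display} {T : measurableType d}.
Variables (P : probability T R) (a : nat -> T -> Cplx R).
Hypothesis a_iid : iid_std_complex_normal P a.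

Lemma iid_mcplx n : mcplx (a n).
Proof. exact: mcplx_normal (a_iid.1 n). Qed.

Lemma measurable_radial n (Q : set R) : measurable Q ->
  measurable [set w | Q (nrm (a n w))].
Proof.
move=> mQ; have := measurable_nrm (iid_mcplx n) measurableT mQ.
by rewrite setTI.
Qed.

(** The form of independence that is used: every event of the proof
    constrains the moduli [|a_j|] separately. *)
Lemma radial_independence (J : seq nat) (Q : nat -> set R) : uniq J ->
  (forall j, measurable (Q j)) ->
  P (\bigcap_(j in [set` J]) [set w | Q j (nrm (a j w))]) =
  (\prod_(j <- J) P [set w | Q j (nrm (a j w))])%E.
Proof.
move=> uJ mQ.
pose plane := (measurableTypeR R * measurableTypeR R)%type.
pose toC (p : plane) : Cplx R := Complex p.1 p.2.
have mC : mcplx toC by split; [exact: measurable_fst|exact: measurable_snd].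
pose B j : set plane := [set p | Q j (nrm (toC p))].
have mB j : measurable (B j).
  by have := measurable_nrm mC measurableT (mQ j); rewrite setTI.
have e j : (plane_of \o a j) @^-1` B j = [set w | Q j (nrm (a j w))].
  apply/funext => w; rewrite /B /= /toC /plane_of /=.
  by case: (a j w).
have := a_iid.2 J B uJ mB.
under eq_bigcapr do rewrite e.
by under eq_bigr do rewrite e.
Qed.

End independence.

(** Weierstrass product inequality; it bounds infinitely many independent
    likely events uniformly from below. *)
Lemma prod_ge_subsum (R : realType) (I : Type) (s : seq I) (p : I -> R) :
  (forall i, 0 <= p i <= 1) ->
  1 - \sum_(i <- s) (1 - p i) <= \prod_(i <- s) p i.
Proof.
move=> p01.
have S0 : forall l, 0 <= \sum_(i <- l) (1 - p i).
  by move=> l; rewrite sumr_ge0// => i _; have := p01 i; lra.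
elim: s => [|i s IH]; first by rewrite !big_nil subr0.
rewrite !big_cons; have /andP[p0 p1] := p01 i.
have := ler_wpM2l p0 IH; apply: le_trans.
have := S0 s; set S := \sum_(_ <- _) _ => S1.
have : 0 <= (1 - p i) * S by rewrite mulr_ge0//; lra.
lra.
Qed.

(** * Upper bound *)
Section upper_bound.
Context {R : realType} {d : measure_display} {T : measurableType d}.
Variables (P : probability T R) (a : nat -> T -> Cplx R).
Hypothesis a_iid : iid_std_complex_normal P a.
Variable r : R.
Hypothesis r0 : 0 < r.

Let overcrowded m := [set w | (m%:R%:E <= num_zeros (planar_gaf a w) r)%E].

Definition huge_coef (M : R) n := [set w | M * 2 ^+ n < nrm (a n w)].

Lemma measurable_huge_coef M n : measurable (huge_coef M n).
Proof.
have := measurable_radial a_iid n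
  (@measurable_itv R `]M * 2 ^+ n, +oo[%R : measurable `]M * 2 ^+ n, +oo[%classic).
by under eq_set do rewrite /= in_itv /= andbT.
Qed.

(** Union bound: [4^n >= 1 + 2 n] turns the Gaussian tails at [M 2^n] into a
    geometric series with ratio at most [1/2]. *)
Lemma prob_huge_coef M : 1 <= M ->
  (P (\bigcup_n huge_coef M n) <= (4 * expR (- (M ^+ 2 / 2)))%:E)%E.
Proof.
move=> M1; have M0 : 0 <= M by lra.
have mH := measurable_huge_coef M.
apply: le_trans (measure_sigma_subadditive P mH _ (@subset_refl _ _)) _.
  exact: bigcup_measurable.
apply: lime_le; first by apply: is_cvg_nneseries.
apply: nearW => N.
pose E := expR (- (M ^+ 2 / 2)).
have term n : (P (huge_coef M n) <= (2 * E * (1 / 2) ^+ n)%:E)%E.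
  have := @prob_tail_le _ _ _ P _ (a_iid.1 n) (M * 2 ^+ n).
  rewrite mulr_ge0 ?exprn_ge0// => /(_ isT)/le_trans; apply.
  rewrite lee_fin -mulrA ler_wpM2l//.
  have h : M ^+ 2 / 2 + n%:R <= (M * 2 ^+ n) ^+ 2 / 2.
    rewrite exprMn.
    have h4 : 1 + 2 * n%:R <= (2 ^+ n) ^+ 2 :> R.
      rewrite exprAC -natrX -[(2 ^ 2)%N]/4%N.
      elim: n => [|n IH]; first by rewrite expr0; lra.
      by rewrite exprS -natr1; have := ler0n R n; lra.
    have m2 : 1 <= M ^+ 2 by rewrite exprn_ege1.
    have n0 : 0 <= n%:R :> R by [].
    have := ler_wpM2l (sqr_ge0 M) h4.
    have := mulr_ge0 n0 (_ : 0 <= M ^+ 2 - 1); rewrite subr_ge0 => /(_ m2).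
    lra.
  apply: (@le_trans _ _ (expR (- (M ^+ 2 / 2) + - n%:R))).
    by rewrite ler_expR; lra.
  rewrite expRD ler_wpM2l ?expR_ge0// expRN -(mul1r n%:R) expRM_natr.
  rewrite div1r exprVn lef_pV2 ?posrE ?exprn_gt0 ?expR_gt0//.
  rewrite lerXn2r ?nnegrE ?expR_ge0//.
  by have := expR_ge1Dx (1 : R); lra.
apply: le_trans (lee_sum _ (fun n _ => term n)) _.
rewrite sumEFin lee_fin.
have E0 : 0 <= 2 * E by rewrite mulr_ge0// expR_ge0.
have := @sum_geometric_le R 2 1 (2 * E) N E0.
have -> : 4 * expR (- (M ^+ 2 / 2)) = 2 * E * 2 / (2 - 1).
  rewrite /E; field; lra.
by apply; lra.
Qed.

Lemma fact_le_expn m k : (k <= m)%N -> (k`! <= m ^ k)%N.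
Proof.
elim: k => [|k IH] km; first by rewrite fact0 expn0.
by rewrite factS expnS leq_mul// IH// ltnW.
Qed.

(** Pairing [k] with [m - 1 - k], each product [k! (m - 1 - k)!] is at most
    [m^m]. *)
Lemma superfactorial_le m : (1 <= m)%N ->
  ln (\prod_(k < m) k`!%:R) <= 2^-1 * m%:R ^+ 2 * ln m%:R :> R.
Proof.
move=> m1; set F := \prod_(k < m) _.
have F0 : 0 < F by apply: prodr_gt0 => k _; rewrite ltr0n fact_gt0.
have m0 : 0 < m%:R :> R by rewrite ltr0n.
have FF : F * F <= (m%:R ^+ m) ^+ m.
  rewrite {2}/F (reindex_inj rev_ord_inj) -big_split /=.
  rewrite -[X in _ <= _ ^+ X]card_ord -prodr_const; apply: ler_prod => k _.
  rewrite mulr_ge0//= -natrM -natrX ler_nat.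
  have km := ltn_ord k.
  rewrite (@leq_trans (m ^ k * m ^ (m - k.+1)))//.
    by rewrite leq_mul// fact_le_expn// ?leq_subr// ltnW.
  rewrite -expnD leq_pexp2l// subnS.
  by rewrite (leq_trans (leq_add (leqnn k) (leq_pred _)))// subnKC// ltnW.
have : ln (F * F) <= ln ((m%:R ^+ m) ^+ m).
  by rewrite ler_ln ?posrE ?mulr_gt0 ?exprn_gt0.
clearbody F; rewrite lnM ?posrE// (lnXn _ (exprn_gt0 m m0)) (lnXn _ m0).
rewrite -mulrnA -[_ *+ (m * m)]mulr_natl natrM expr2; lra.
Qed.

(** The factor [e^(6 + 4 r^2)] dominates, per unit of [m], the growth bound at
    radius [r + sqrt m] when [|a_n| <= e^(2 m) 2^n]; the factor [2 (r + 1)]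
    is the one of [has_zeros_coef_le]. *)
Definition growth_const : R := expR (6 + 4 * r ^+ 2) * (2 * (r + 1)).

Lemma growth_const_gt0 : 0 < growth_const.
Proof. by rewrite mulr_gt0 ?expR_gt0// mulr_gt0// ltr_wpDl// ltW. Qed.

Definition small_radius m k : R :=
  Num.sqrt (k`!%:R) * (growth_const ^+ m / Num.sqrt m%:R ^+ m).

Definition small_coefs m := \bigcap_(k in [set` iota 0 m])
  [set w | `]-oo, small_radius m k]%classic (nrm (a k w))].

Lemma measurable_small_coefs m : measurable (small_coefs m).
Proof.
apply: fin_bigcap_measurable => // k _.
by apply: (measurable_radial a_iid); exact: measurable_itv.
Qed.

(** Uses the growth bound at radius [s = r + sqrt m]. This radius makes
    [(s - r)^(-m)] equal to [m^(-m/2)] while [e^(2 s^2)] is still exponential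
    in [m]. The event of divergence, where the sample function is zero and
    overcrowded by convention, is covered by the huge coefficients. *)
Lemma overcrowded_sub m : (1 <= m)%N ->
  overcrowded m `<=` \bigcup_n huge_coef (expR (2 * m%:R)) n `|` small_coefs m.
Proof.
move=> m1 w; rewrite /overcrowded overcrowdedE /= => hz.
set M := expR (2 * m%:R).
have [|/forallNP nH] := pselect (exists n, huge_coef M n w).
  by move=> [n hn]; left; exists n.
have aM n : nrm (a n w) <= M * 2 ^+ n by rewrite leNgt; exact/negP/nH.
right; move=> k /= ; rewrite mem_iota add0n /= => km.
rewrite in_itv /=.
have cE : sample_coef a w = gaf_coef a w.
  by rewrite /sample_coef asboolT//; exact: gaf_coef_entire aM.
rewrite cE in hz.
have m0 : 0 < m%:R :> R by rewrite ltr0n.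
have q0 : 0 < Num.sqrt m%:R :> R by rewrite sqrtr_gt0.
have s0 : 0 < r + Num.sqrt m%:R by rewrite addr_gt0.
have cA := gaf_coef_bd s0 aM.
have rs : r < r + Num.sqrt m%:R by rewrite ltrDl.
have := has_zeros_coef_le r0 rs (_ : r <= r + 1) (_ : 1 <= r + 1) cA hz km.
rewrite !lerDl !lerDr ler01 (ltW r0) => /(_ isT isT).
rewrite [r + _ - r]addrC addKr => h.
rewrite nrm_gaf_coef /small_radius ler_wpM2l ?sqrtr_ge0//.
apply: le_trans h _; rewrite ler_wpM2r ?invr_ge0 ?exprn_ge0 ?sqrtr_ge0//.
rewrite /growth_const [leRHS]exprMn ler_wpM2r//.
  by rewrite exprn_ge0// mulr_ge0// ltW// ltr_wpDl// ltW.
rewrite /M -expRD -expRM_natl ler_expR.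
set q := Num.sqrt m%:R in q0 *.
have qE : q ^+ 2 = m%:R by rewrite sqr_sqrtr// ltW.
have := sqr_ge0 (r - q).
have : r ^+ 2 <= m%:R * r ^+ 2 by rewrite ler_peMl ?sqr_ge0// ler1n.
rewrite !sqrrD sqrrN qE; lra.
Qed.

(** The exponent is [m^2 log m] from the [m] factors [m^(-m)], reduced by half
    of it because of the factorials. *)
Lemma prob_small_coefs m : (1 <= m)%N ->
  (P (small_coefs m) <= (expR (- (2^-1 * m%:R ^+ 2 * ln m%:R) +
     (ln 2 + 2 * ln growth_const) * m%:R ^+ 2))%:E)%E.
Proof.
move=> m1; have m0 : 0 < m%:R :> R by rewrite ltr0n.
have L0 := growth_const_gt0; set L := growth_const in L0 *.
pose Y := (L ^+ m / Num.sqrt m%:R ^+ m) ^+ 2.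
have Y0 : 0 < Y by rewrite exprn_gt0// divr_gt0// exprn_gt0// sqrtr_gt0.
have lnY : ln Y = 2 * (m%:R * ln L) - m%:R * ln m%:R.
  have -> : Y = (L ^+ m) ^+ 2 / m%:R ^+ m.
    by rewrite /Y expr_div_n [X in _ / X]exprAC sqr_sqrtr// ltW.
  rewrite ln_div ?posrE ?exprn_gt0// (lnXn _ (exprn_gt0 m L0)) (lnXn _ L0).
  rewrite (lnXn _ m0) -mulrnA -[ln L *+ _]mulr_natl -[ln m%:R *+ _]mulr_natl.
  by rewrite natrM; ring.
rewrite /small_coefs (radial_independence a_iid
  (Q := fun k => `]-oo, small_radius m k]%classic) (iota_uniq _ _)); last first.
  by move=> j; exact: measurable_itv.
pose F : R := \prod_(k < m) k`!%:R.
have F0 : 0 < F by apply: prodr_gt0 => k _; rewrite ltr0n fact_gt0.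
apply: (@le_trans _ _ (\prod_(k <- iota 0 m) (2 * Y * k`!%:R)%:E)%E).
  elim: (iota 0 m) => [|k l IH]; first by rewrite !big_nil.
  rewrite !big_cons; apply: lee_pmul => //.
    by apply: prode_ge0.
  have x0 : 0 <= small_radius m k.
    by rewrite mulr_ge0 ?sqrtr_ge0// divr_ge0 ?exprn_ge0 ?sqrtr_ge0// ltW.
  rewrite (_ : [set w | _] = [set w | (nrm (a k w) <= small_radius m k)%R]).
    apply: le_trans (prob_disk_le (a_iid.1 k) x0) _.
    rewrite lee_fin /small_radius exprMn sqr_sqrtr// -/Y le_eqVlt.
    by apply/orP; left; apply/eqP; ring.
  by apply/seteqP; split => w /=; rewrite in_itv.
rewrite prodEFin lee_fin.
have -> : iota 0 m = index_iota 0 m by rewrite /index_iota subn0.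
rewrite big_mkord big_split /= prodr_const card_ord -/F.
have Z0 : 0 < (2 * Y) ^+ m * F by rewrite mulr_gt0// exprn_gt0// mulr_gt0.
rewrite -[leLHS](lnK Z0) ler_expR.
have Y20 : 0 < 2 * Y by rewrite mulr_gt0.
have -> : ln ((2 * Y) ^+ m * F) = m%:R * (ln 2 + ln Y) + ln F.
  have p0 : 0 < (2 * Y) ^+ m by rewrite exprn_gt0.
  rewrite (lnM p0 F0) (lnXn _ Y20) -[_ *+ m]mulr_natl.
  by congr (_ * _ + _); apply: lnM; rewrite posrE.
rewrite lnY.
have := superfactorial_le m1; rewrite -/F.
have l2 : 0 <= ln 2 :> R by rewrite ln_ge0// ler1n.
have : m%:R * ln 2 <= m%:R ^+ 2 * ln 2 :> R.
  by rewrite ler_wpM2r// expr2 ler_peMl ?(ltW m0)// ler1n.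
rewrite expr2; lra.
Qed.

(** The huge coefficients contribute [4 e^(- e^(4 m) / 2)], which is negligible
    since [e^(4 m) >= m^4 >= m^2 log m]. *)
Lemma overcrowding_upper_bound : exists C : R, forall m : nat, (1 <= m)%N ->
  (P (overcrowded m) <=
   (expR (- (2^-1 * m%:R ^+ 2 * ln m%:R) + C * m%:R ^+ 2))%:E)%E.
Proof.
set C0 := ln 2 + 2 * ln growth_const.
exists (`|C0| + 4) => m m1; have m0 : 0 < m%:R :> R by rewrite ltr0n.
have mr1 : 1 <= m%:R :> R by rewrite ler1n.
pose M : R := expR (2 * m%:R).
have M1 : 1 <= M by rewrite (le_trans _ (expR_ge1Dx _))// lerDl mulr_ge0// ltW.
have mH : measurable (\bigcup_n huge_coef M n).
  by apply: bigcup_measurable => n _; exact: measurable_huge_coef.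
have mS := measurable_small_coefs m.
apply: (@le_trans _ _ (P (\bigcup_n huge_coef M n `|` small_coefs m))).
  apply: le_measure; last exact: overcrowded_sub.
    rewrite inE; apply: measurable_overcrowded => // n.
    exact: iid_mcplx a_iid n.
  by rewrite inE; exact: measurableU.
apply: (le_trans (measureU2 P mH mS)).
apply: (le_trans (leeD (prob_huge_coef M1) (prob_small_coefs m1))).
rewrite -EFinD lee_fin -/C0.
set e := 2^-1 * m%:R ^+ 2 * ln m%:R.
have m21 : 1 <= m%:R ^+ 2 :> R by rewrite exprn_ege1.
have Me : e <= M ^+ 2 / 2.
  have Mm : m%:R ^+ 2 <= M.
    have -> : M = expR m%:R ^+ 2 by rewrite /M expRM_natl.
    rewrite lerXn2r ?nnegrE ?expR_ge0 ?(ltW m0)//.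
    by rewrite (le_trans _ (expR_ge1Dx _))// lerDr.
  have lnm : ln m%:R <= m%:R ^+ 2 :> R.
    rewrite (le_trans (ltW (ln_sublinear m0)))// expr2 ler_peMr// ltW.
  have := ler_wpM2l (sqr_ge0 (m%:R : R)) lnm.
  have : (m%:R ^+ 2) * (m%:R ^+ 2) <= M * M by rewrite ler_pM ?sqr_ge0.
  rewrite /e -[M ^+ 2]/(M * M); lra.
have h1 : expR (- (M ^+ 2 / 2)) <= expR (- e) by rewrite ler_expR lerN2.
have h2 : expR (- e + C0 * m%:R ^+ 2) <= expR (- e) * expR (`|C0| * m%:R ^+ 2).
  by rewrite -expRD ler_expR lerD2l ler_wpM2r ?sqr_ge0// ler_norm.
set X := expR (`|C0| * m%:R ^+ 2) in h2 *.
have -> : expR (- e + (`|C0| + 4) * m%:R ^+ 2) =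
    expR (- e) * (X * expR (4 * m%:R ^+ 2)).
  by rewrite -!expRD; congr expR; ring.
have X1 : 1 <= X by rewrite (le_trans _ (expR_ge1Dx _))// lerDl mulr_ge0 ?sqr_ge0.
have h4 : 5 <= expR (4 * m%:R ^+ 2) :> R.
  by apply: le_trans (expR_ge1Dx _); lra.
have e0 : 0 <= expR (- e) by exact: expR_ge0.
apply: (@le_trans _ _ (expR (- e) * (X * 5))).
  apply: (@le_trans _ _ (expR (- e) * (4 + X))).
    by rewrite mulrDr; lra.
  by rewrite ler_wpM2l//; lra.
rewrite ler_wpM2l// ler_wpM2l//; lra.
Qed.

End upper_bound.

(** * Lower bound *)
Section lower_bound.
Context {R : realType} {d : measure_display} {T : measurableType d}.
Variables (P : probability T R) (a : nat -> T -> Cplx R).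
Hypothesis a_iid : iid_std_complex_normal P a.
Variable r : R.
Hypothesis r0 : 0 < r.

Let overcrowded m := [set w | (m%:R%:E <= num_zeros (planar_gaf a w) r)%E].

(** Chosen so that [(8 * shrink)^m <= r^(m - i)] for all [i <= m], where [8^m]
    is the smallness required of the lower coefficients. *)
Definition shrink : R := Num.min r 1 / 8.

(** The power of [sqrt m] compensates [sqrt (m! / n!) <= sqrt m ^ (m - n)]. *)
Definition low_radius m n : R := shrink ^+ m / Num.sqrt m%:R ^+ (m - n).

(** Large enough for the terms of degree above [m], of which the sum is at most
    [2 e^(8 r^2) r^m / sqrt (m!)] on the event, to be at most an eighth of the
    term of degree [m]; the summand [4] serves the terms below. *)
Definition pivot : R := 4 + 16 * expR (8 * r ^+ 2).

(** The range allowed for [|a_n|] on the favourable event. *)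
Definition window m n : set R :=
  if (n < m)%N then `]-oo, low_radius m n]%classic
  else if n == m then `[pivot, +oo[%classic
  else `]-oo, 2 * 2 ^+ (n - m)]%classic.

Definition in_window m n := [set w | window m n (nrm (a n w))].

(** Finitely many constraints, to which independence applies; the full event is
    reached by continuity from above. *)
Definition good_upto m N := \bigcap_(n in [set` iota 0 (m + N.+1)]) in_window m n.

Definition good m := \bigcap_N good_upto m N.

Lemma shrink_gt0 : 0 < shrink.
Proof. by rewrite divr_gt0// lt_min r0 ltr01. Qed.

Lemma pivot_ge : 4 <= pivot /\ 16 * expR (8 * r ^+ 2) <= pivot.
Proof. by rewrite /pivot; have := expR_gt0 (8 * r ^+ 2); split; lra. Qed.

Lemma pivot_gt0 : 0 < pivot.
Proof. by have [h _] := pivot_ge; lra. Qed.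

Lemma measurable_window m n : measurable (window m n).
Proof. by rewrite /window; case: ifP => _; [|case: ifP => _]; exact: measurable_itv. Qed.

Lemma measurable_in_window m n : measurable (in_window m n).
Proof. by apply: (measurable_radial a_iid); exact: measurable_window. Qed.

Lemma measurable_good_upto m N : measurable (good_upto m N).
Proof.
by apply: fin_bigcap_measurable => // n _; exact: measurable_in_window.
Qed.

Lemma measurable_good m : measurable (good m).
Proof. by apply: bigcapT_measurable => N; exact: measurable_good_upto. Qed.

Lemma fact_le_shift i k : ((i + k)`! <= i`! * (i + k) ^ k)%N.
Proof.
elim: k => [|k IH]; first by rewrite addn0 expn0 muln1.
rewrite addnS factS expnS mulnCA leq_mul2l/= (leq_trans IH)//.
by rewrite leq_mul2l; apply/orP; right; case: k {IH} => // k; rewrite leq_exp2r.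
Qed.

Lemma fact_mul_le i k : (i`! * k`! <= (i + k)`!)%N.
Proof.
elim: k => [|k IH]; first by rewrite fact0 muln1 addn0.
rewrite addnS !factS mulnCA leq_mul// ltnS leq_addl//.
Qed.

(** The stronger statement proved by induction keeps track of what is left of
    the geometric series [sum_(j >= 1) 2^(-j) = 1]; truncated subtraction makes
    it correct also when [N <= m.+1]. *)
Lemma sum_half_powers m N :
  \sum_(i < N | (m < i)%N) (1 / 2) ^+ (i - m) <= 1 :> R.
Proof.
suff : \sum_(i < N | (m < i)%N) (1 / 2) ^+ (i - m) + (1 / 2) ^+ (N - m.+1) <= 1 :> R.
  have : 0 <= (1 / 2) ^+ (N - m.+1) :> R by rewrite exprn_ge0//; lra.
  lra.
elim: N => [|N IH]; first by rewrite big_ord0 add0r expr0.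
rewrite big_mkcond big_ord_recr -big_mkcond /=; case: ltnP => mN.
  rewrite subSS -addrA; have e : (N - m = (N - m.+1).+1)%N by rewrite subnSK.
  rewrite (_ : (1 / 2) ^+ (N - m) + (1 / 2) ^+ (N - m) = (1 / 2) ^+ (N - m.+1))//.
  by rewrite e exprS; field.
move: IH; rewrite subSS; have /eqP -> : (N - m.+1 == 0)%N by rewrite subn_eq0 ltnW.
have /eqP -> : (N - m == 0)%N by rewrite subn_eq0.
by rewrite addr0.
Qed.

(** For [i < m], [sqrt (m!) <= sqrt (i!) * sqrt m ^ (m - i)] bounds the lower
    terms; for [i = m + j], [m! * j! <= i!] bounds the upper ones by a
    convergent series that does not depend on [m]. *)
Lemma good_sub_overcrowded m : (1 <= m)%N -> good m `<=` overcrowded m.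
Proof.
move=> m1 w gw; have m0 : 0 < m%:R :> R by rewrite ltr0n.
have hw n : window m n (nrm (a n w)).
  by apply: (gw n I n); rewrite /= mem_iota /= add0n addnS ltnS leq_addl.
have wlow i : (i < m)%N -> nrm (a i w) <= low_radius m i.
  by move=> im; have := hw i; rewrite /window im /= in_itv.
have wpiv : pivot <= nrm (a m w).
  by have := hw m; rewrite /window ltnn eqxx /= in_itv /= andbT.
have whigh i : (m < i)%N -> nrm (a i w) <= 2 * 2 ^+ (i - m).
  by move=> mi; have := hw i; rewrite /window ltnNge (ltnW mi) gtn_eqF//= in_itv.
have ce : entire (gaf_coef a w).
  apply: (@gaf_coef_entire _ _ _ _ _ (2 + \sum_(i < m.+1) nrm (a i w))) => n.
  have S0 : 0 <= \sum_(i < m.+1) nrm (a i w).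
    by rewrite sumr_ge0// => i _; exact: nrm_ge0.
  have [nm|mn] := leqP n m.
    apply: (@le_trans _ _ (2 + \sum_(i < m.+1) nrm (a i w))).
      rewrite (bigD1 (Ordinal (nm : (n < m.+1)%N)))//= addrCA lerDl.
      by rewrite addr_ge0// sumr_ge0// => i _; exact: nrm_ge0.
    by rewrite ler_peMr ?addr_ge0// exprn_ege1// ler1n.
  apply: le_trans (whigh n mn) _; rewrite ler_pM ?exprn_ge0//.
    by rewrite lerDl.
  by rewrite ler_weXn2l ?leq_subr// ler1n.
rewrite /overcrowded overcrowdedE /= /sample_coef asboolT//.
have sf k : 0 < Num.sqrt (k`!%:R) :> R by rewrite sqrtr_gt0 ltr0n fact_gt0.
have nc n : nrm (gaf_coef a w n) = nrm (a n w) / Num.sqrt (n`!%:R).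
  by rewrite /gaf_coef nrmM nrmV nrm_real ger0_norm ?sqrtr_ge0.
have [K4 K16] := pivot_ge.
have am0 : 0 < nrm (a m w) by rewrite (lt_le_trans pivot_gt0).
apply: dominant_has_zeros => //.
- by rewrite -nrm_eq0 nc gt_eqF// divr_gt0.
- move=> i im; rewrite !nc.
  have s0 : 0 < Num.sqrt m%:R :> R by rewrite sqrtr_gt0.
  have S0 : 0 < Num.sqrt m%:R ^+ (m - i) :> R by rewrite exprn_gt0.
  have DS : Num.sqrt (m`!%:R) <= Num.sqrt (i`!%:R) * Num.sqrt m%:R ^+ (m - i) :> R.
    have -> : Num.sqrt m%:R ^+ (m - i) = Num.sqrt (m%:R ^+ (m - i)) :> R.
      rewrite -[RHS]ger0_norm ?sqrtr_ge0//.
      apply/eqP; rewrite -(@eqrXn2 _ 2) ?exprn_ge0 ?sqrtr_ge0//.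
      by rewrite exprAC ger0_norm ?sqrtr_ge0// !sqr_sqrtr// exprn_ge0// ltW.
    rewrite -sqrtrM// ler_wsqrtr// -natrX -natrM ler_nat.
    by have := fact_le_shift i (m - i); rewrite subnKC// ltnW.
  have q0 : 0 < 8 * shrink by rewrite mulr_gt0// shrink_gt0.
  have qr : 8 * shrink <= r.
    by rewrite /shrink mulrC divfK// ge_min lexx.
  have q1 : 8 * shrink <= 1.
    by rewrite /shrink mulrC divfK// ge_min lexx orbT.
  have key : shrink ^+ m * r ^+ i * 8 ^+ m <= r ^+ m.
    have e (x : R) : x ^+ m = x ^+ (m - i) * x ^+ i.
      by rewrite -exprD subnK// ltnW.
    rewrite mulrAC -exprMn [shrink * 8]mulrC (e (8 * shrink)) (e r).
    rewrite -mulrA ler_pM ?mulr_ge0 ?exprn_ge0 ?(ltW q0) ?(ltW r0)//.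
      by rewrite lerXn2r ?nnegrE ?(ltW q0) ?(ltW r0).
    by rewrite ler_piMl ?exprn_ge0 ?(ltW r0)// exprn_ile1// ltW.
  have p8 : 0 < 8 ^+ m :> R by rewrite exprn_gt0.
  apply: (@le_trans _ _ (shrink ^+ m * r ^+ i / Num.sqrt (m`!%:R))).
    rewrite [leRHS]mulrAC ler_wpM2r ?exprn_ge0 ?(ltW r0)//.
    rewrite ler_pdivrMr// (le_trans (wlow i im))// /low_radius ler_pdivrMr//.
    rewrite -mulrA -[leRHS]mulrA ler_peMr ?exprn_ge0 ?(ltW shrink_gt0)//.
    by rewrite mulrC ler_pdivlMr// mul1r.
  rewrite [leRHS](_ : _ =
    (nrm (a m w) / 4) * (r ^+ m / 8 ^+ m / Num.sqrt (m`!%:R))); last first.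
    by field; rewrite !gt_eqF.
  apply: (@le_trans _ _ (r ^+ m / 8 ^+ m / Num.sqrt (m`!%:R))).
    by rewrite ler_wpM2r ?invr_ge0 ?sqrtr_ge0// ler_pdivlMr.
  rewrite ler_peMl ?divr_ge0 ?exprn_ge0 ?sqrtr_ge0 ?(ltW r0)//.
  by rewrite ler_pdivlMr// mul1r (le_trans K4).
- move=> N; pose W := r ^+ m / Num.sqrt (m`!%:R).
  have W0 : 0 <= W by rewrite divr_ge0 ?exprn_ge0 ?sqrtr_ge0// ltW.
  apply: (@le_trans _ _ (\sum_(i < N | (m < i)%N)
      2 * expR (8 * r ^+ 2) * W * (1 / 2) ^+ (i - m))).
    apply: ler_sum => i mi; rewrite nc.
    have := @sqrt_fact_ratio_le R (2 * r) (i - m) (_ : 0 <= 2 * r).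
    rewrite mulr_ge0 ?(ltW r0)// => /(_ isT).
    rewrite (_ : 2 * (2 * r) ^+ 2 = 8 * r ^+ 2); last by ring.
    set j := (i - m)%N => hj.
    have ij : nat_of_ord i = (m + j)%N by rewrite /j subnKC// ltnW.
    have FF : Num.sqrt (m`!%:R) * Num.sqrt (j`!%:R) <= Num.sqrt (i`!%:R) :> R.
      by rewrite -sqrtrM// ler_wsqrtr// -natrM ler_nat ij fact_mul_le.
    apply: (@le_trans _ _ (2 * 2 ^+ j / (Num.sqrt (m`!%:R) * Num.sqrt (j`!%:R)) * r ^+ i)).
      rewrite ler_wpM2r ?exprn_ge0 ?(ltW r0)// ler_pM ?nrm_ge0 ?invr_ge0 ?sqrtr_ge0//.
        exact: whigh.
      by rewrite lef_pV2 ?posrE ?mulr_gt0.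
    rewrite [leLHS](_ : _ =
        (2 * W * (1 / 2) ^+ j) * ((2 * (2 * r)) ^+ j / Num.sqrt (j`!%:R))).
      rewrite [leRHS](_ : _ = (2 * W * (1 / 2) ^+ j) * expR (8 * r ^+ 2)); last by ring.
      have half0 : 0 <= 1 / 2 :> R by lra.
      apply: ler_wpM2l hj; apply: mulr_ge0; last exact: exprn_ge0.
      exact: mulr_ge0.
    rewrite ij exprD /W !exprMn expr1n mul1r exprVn; field.
    by rewrite !gt_eqF ?exprn_gt0.
  rewrite -mulr_sumr.
  have E0 : 0 <= 2 * expR (8 * r ^+ 2) * W.
    by apply: mulr_ge0 => //; rewrite mulr_ge0// expR_ge0.
  apply: (le_trans (ler_wpM2l E0 (sum_half_powers m N))).
  rewrite mulr1 nc [leRHS](_ : _ = nrm (a m w) / 8 * W); last first.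
    by rewrite /W; ring.
  by rewrite ler_wpM2r//; lra.
Qed.

Let kappa : R := pi^-1 * expR (- 2).
Let kappa_pivot : R := pi^-1 * expR (- ((pivot + 1) ^+ 2 + (pivot + 1) ^+ 2)).

Lemma kappa_gt0 : 0 < kappa.
Proof. by rewrite mulr_gt0 ?expR_gt0// invr_gt0 pi_gt0. Qed.

Lemma kappa_pivot_gt0 : 0 < kappa_pivot.
Proof. by rewrite mulr_gt0 ?expR_gt0// invr_gt0 pi_gt0. Qed.

Lemma low_radius_bounds m n : (1 <= m)%N -> 0 < low_radius m n <= 1.
Proof.
move=> m1; have s1 : 1 <= Num.sqrt m%:R :> R.
  by rewrite -[leLHS]sqrtr1 ler_wsqrtr// ler1n.
have s0 : 0 < Num.sqrt m%:R :> R by rewrite (lt_le_trans ltr01).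
rewrite /low_radius divr_gt0 ?exprn_gt0 ?shrink_gt0//=.
rewrite ler_pdivrMr ?exprn_gt0// mul1r (@le_trans _ _ 1)//.
  rewrite exprn_ile1// ?(ltW shrink_gt0)// /shrink ler_pdivrMr// mul1r.
  by rewrite ge_min; apply/orP; right; rewrite ler1n.
by rewrite exprn_ege1.
Qed.

Lemma prob_in_windowE m n : P (in_window m n) = (fine (P (in_window m n)))%:E.
Proof. by rewrite fineK// fin_num_measure//; exact: measurable_in_window. Qed.

Lemma prob_low m n : (1 <= m)%N -> (n < m)%N ->
  kappa * low_radius m n ^+ 2 <= fine (P (in_window m n)).
Proof.
move=> m1 nm; rewrite -lee_fin -prob_in_windowE.
rewrite (_ : in_window m n = [set w | (nrm (a n w) <= low_radius m n)%R]).
  apply: prob_disk_ge (a_iid.1 n) _ _.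
  by have /andP[h1 ->] := low_radius_bounds n m1; rewrite (ltW h1).
by apply/seteqP; split => w; rewrite /in_window /window nm /= in_itv.
Qed.

Lemma prob_pivot m : kappa_pivot <= fine (P (in_window m m)).
Proof.
rewrite -lee_fin -prob_in_windowE.
rewrite (_ : in_window m m = [set w | (pivot <= nrm (a m w))%R]).
  by apply: prob_codisk_ge (a_iid.1 m) _ _; exact: ltW pivot_gt0.
apply/seteqP; split => w; rewrite /in_window /window ltnn eqxx /= in_itv /= ?andbT//.
Qed.

Lemma prob_in_window_01 m n : 0 <= fine (P (in_window m n)) <= 1.
Proof.
rewrite fine_ge0//= -lee_fin -prob_in_windowE probability_le1//.
exact: measurable_in_window.
Qed.

(** With [y = 2 * 4^(k+1)] the tail is at most [2 e^(-y) <= 2 / y]. *)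
Lemma prob_high m k :
  1 - fine (P (in_window m (m.+1 + k))) <= 1 / 2 * (1 / 2) ^+ k.+1.
Proof.
set n := (m.+1 + k)%N; have nm : (n - m = k.+1)%N by rewrite /n addSnnS addKn.
have mn : (m < n)%N by rewrite /n addSn ltnS leq_addr.
have mW := measurable_in_window m n.
rewrite -lee_fin EFinB -prob_in_windowE -probability_setC//.
rewrite (_ : ~` in_window m n = [set w | (2 * 2 ^+ k.+1 < nrm (a n w))%R]).
  have x0 : 0 <= 2 * 2 ^+ k.+1 :> R by rewrite mulr_ge0// exprn_ge0.
  apply: le_trans (prob_tail_le (a_iid.1 n) x0) _; rewrite lee_fin.
  have e : (2 * 2 ^+ k.+1) ^+ 2 / 2 = 2 * 4 ^+ k.+1 :> R.
    rewrite exprMn exprAC (_ : 2 ^+ 2 = 4 :> R); last by ring.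
    by field.
  rewrite e expRN.
  have p4 : 0 < 4 ^+ k.+1 :> R by rewrite exprn_gt0.
  have h : 2 * 4 ^+ k.+1 <= expR (2 * 4 ^+ k.+1) :> R.
    by rewrite (le_trans _ (expR_ge1Dx _))// lerDr.
  apply: (@le_trans _ _ ((4 ^+ k.+1)^-1)).
    rewrite [leRHS](_ : _ = 2 * (2 * 4 ^+ k.+1)^-1); last by field; rewrite gt_eqF.
    rewrite ler_wpM2l//.
    by rewrite lef_pV2 ?posrE ?expR_gt0 ?mulr_gt0.
  have p2 : 0 < 2 ^+ k.+1 :> R by rewrite exprn_gt0.
  have -> : 4 ^+ k.+1 = 2 ^+ k.+1 * 2 ^+ k.+1 :> R.
    by rewrite -exprMn; congr (_ ^+ _); ring.
  rewrite invfM (_ : (1 / 2) ^+ k.+1 = (2 ^+ k.+1)^-1); last first.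
    by rewrite -exprVn; congr (_ ^+ _); lra.
  rewrite ler_wpM2r ?invr_ge0 ?(ltW p2)// div1r lef_pV2 ?posrE//.
  by rewrite exprS ler_peMr// exprn_ege1// ler1n.
apply/seteqP; split => w; rewrite /in_window /window ltnNge (ltnW mn) gtn_eqF//= in_itv /= nm.
  by move=> /negP; rewrite -ltNge.
by rewrite ltNge => /negP.
Qed.

(** The constraints above [m] fail with total probability at most [1/2], so
    they cost a factor [1/2] whatever their number. *)
Lemma prob_good_upto m N : (1 <= m)%N ->
  (((\prod_(n < m) (kappa * low_radius m n ^+ 2)) * (kappa_pivot / 2))%:E <=
   P (good_upto m N))%E.
Proof.
move=> m1; rewrite /good_upto.
rewrite (radial_independence a_iid (iota_uniq _ _) (measurable_window m)).
rewrite (eq_bigr (fun n => (fine (P (in_window m n)))%:E)); last first.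
  by move=> n _; exact: prob_in_windowE.
rewrite prodEFin lee_fin iotaD big_cat /= add0n.
have p0 n : 0 <= fine (P (in_window m n)) by have /andP[] := prob_in_window_01 m n.
apply: ler_pM.
- by rewrite prodr_ge0// => n _; rewrite mulr_ge0 ?sqr_ge0// ltW// kappa_gt0.
- by rewrite divr_ge0// ltW// kappa_pivot_gt0.
- have -> : iota 0 m = index_iota 0 m by rewrite /index_iota subn0.
  rewrite big_mkord; apply: ler_prod => n _; rewrite prob_low//.
  by rewrite mulr_ge0 ?sqr_ge0// ltW// kappa_gt0.
rewrite big_cons; apply: ler_pM => //; first exact: ltW kappa_pivot_gt0.
  exact: prob_pivot.
rewrite -[m.+1]addn0 iotaDl big_map.
have := prod_ge_subsum (iota 0 N) (fun k => prob_in_window_01 m (m.+1 + k)).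
apply: le_trans.
have : \sum_(k <- iota 0 N) (1 - fine (P (in_window m (m.+1 + k)))) <=
    \sum_(k <- iota 0 N) 1 / 2 * (1 / 2) ^+ k.+1.
  by apply: ler_sum => k _; exact: prob_high.
have : \sum_(k <- iota 0 N) 1 / 2 * (1 / 2) ^+ k.+1 <= 1 / 2 :> R.
  have -> : iota 0 N = index_iota 0 N by rewrite /index_iota subn0.
  have half0 : 0 <= 1 / 2 :> R by lra.
  rewrite -mulr_sumr ler_piMr//.
  suff -> : \sum_(0 <= i < N) (1 / 2) ^+ i.+1 = 1 - (1 / 2) ^+ N :> R.
    by rewrite gerBl exprn_ge0//; lra.
  elim: N => [|N IH]; first by rewrite big_nil expr0 subrr.
  by rewrite big_nat_recr//= IH exprS; lra.
lra.
Qed.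

Lemma prob_good m : (1 <= m)%N ->
  (((\prod_(n < m) (kappa * low_radius m n ^+ 2)) * (kappa_pivot / 2))%:E <=
   P (good m))%E.
Proof.
move=> m1.
have cv : P \o good_upto m @ \oo --> P (good m).
  apply: nonincreasing_cvg_mu.
  - by rewrite (le_lt_trans (probability_le1 _ (measurable_good_upto m 0)))// ltry.
  - exact: measurable_good_upto.
  - exact: measurable_good.
  - move=> N N' NN'; apply/subsetPset => w h n nN; apply: h.
    move: nN; rewrite /= !mem_iota /= !add0n => /leq_trans; apply.
    by rewrite leq_add2l ltnS.
rewrite -(cvg_lim _ cv)//; apply: lime_ge; first exact: cvgP cv.
by apply: nearW => N; exact: prob_good_upto.
Qed.

Lemma sum_rev_succ m : \sum_(n < m) (m - n)%:R = 2^-1 * (m%:R ^+ 2 + m%:R) :> R.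
Proof.
elim: m => [|m IH]; first by rewrite big_ord0 expr0n /= addr0 mulr0.
by rewrite big_ord_recl /= subn0 (eq_bigr (fun n : 'I_m => (m - n)%:R))// IH -natr1; field.
Qed.

Lemma overcrowding_lower_bound : exists C : R, forall m : nat, (1 <= m)%N ->
  ((expR (- (2^-1 * m%:R ^+ 2 * ln m%:R) - C * m%:R ^+ 2))%:E <=
   P (overcrowded m))%E.
Proof.
exists (`|ln kappa| + 2 * `|ln shrink| + 2^-1 + `|ln (kappa_pivot / 2)|) => m m1.
have m0 : 0 < m%:R :> R by rewrite ltr0n.
have mr1 : 1 <= m%:R :> R by rewrite ler1n.
apply: (@le_trans _ _ (P (good m))); last first.
  apply: le_measure; last exact: good_sub_overcrowded.
    by rewrite inE; exact: measurable_good.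
  rewrite inE; apply: measurable_overcrowded => // n; exact: iid_mcplx a_iid n.
apply: le_trans (prob_good m1); rewrite lee_fin.
have k0 := kappa_gt0; have kp0 := kappa_pivot_gt0; have sh0 := shrink_gt0.
have kp2 : 0 < kappa_pivot / 2 by rewrite divr_gt0.
have factor n : kappa * low_radius m n ^+ 2 =
    expR (ln kappa + 2 * m%:R * ln shrink - (m - n)%:R * ln m%:R).
  rewrite /low_radius expr_div_n [X in _ / X]exprAC sqr_sqrtr ?(ltW m0)//.
  have e1 : expR (2 * m%:R * ln shrink) = (shrink ^+ m) ^+ 2.
    by rewrite -natrM expRM_natl lnK ?posrE// mulnC exprM.
  have e2 : expR ((m - n)%:R * ln m%:R) = m%:R ^+ (m - n) :> R.
    by rewrite expRM_natl lnK ?posrE.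
  by rewrite !expRD expRN e1 e2 lnK ?posrE// mulrA.
under [X in _ <= X * _]eq_bigr do rewrite factor.
rewrite -expR_sum -[X in _ <= _ * X](lnK kp2) -expRD ler_expR.
rewrite big_split/= sumrN -mulr_suml sum_rev_succ sumr_const card_ord.
rewrite -[(ln kappa + _) *+ m]mulr_natl.
set M : R := m%:R in m0 mr1 *; set l := ln M.
have lM : l <= M by rewrite ltW// ln_sublinear.
have l0 : 0 <= l by rewrite ln_ge0.
have M2 : M <= M ^+ 2 by rewrite expr2 ler_peMr// ltW.
have M21 : 1 <= M ^+ 2 by rewrite (le_trans mr1).
have bound (t u : R) : 0 <= u -> u <= M ^+ 2 -> - (`|t| * M ^+ 2) <= u * t.
  move=> u0 uM; rewrite lerNl -mulrN mulrC.
  apply: (@le_trans _ _ (`|t| * u)); last by rewrite ler_wpM2l.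
  by rewrite ler_wpM2r// -normrN ler_norm.
have h1 := bound (ln kappa) M (ltW m0) M2.
have h2 := bound (ln shrink) (M ^+ 2) (sqr_ge0 _) (lexx _).
have h3 := bound (ln (kappa_pivot / 2)) 1 ler01 M21.
have h4 : M * l <= M ^+ 2 by rewrite expr2 ler_wpM2l// ltW.
rewrite -/l; lra.
Qed.

End lower_bound.

(** * From the error [e^(O(m^2))] to the statements of the theorem *)
Section asymptotics.
Context {R : realType}.

(** The left-hand side is positive only while [ln x < C / eps], that is for
    [x] below a constant. *)
Lemma absorb_quadratic (C eps x : R) : 0 < eps -> 1 <= x ->
  C * x ^+ 2 - eps * x ^+ 2 * ln x <= `|C| * expR (`|C| / eps) ^+ 2.
Proof.
move=> e0 x1; have x0 : 0 < x by rewrite (lt_le_trans ltr01).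
have l0 : 0 <= ln x by rewrite ln_ge0.
have E0 := expR_ge0 (`|C| / eps).
have [h|h] := leP C (eps * ln x).
  apply: (@le_trans _ _ 0); last by rewrite mulr_ge0// exprn_ge0.
  have := ler_wpM2l (sqr_ge0 x) h; lra.
have xE : x <= expR (`|C| / eps).
  rewrite -[leLHS]lnK// ler_expR ler_pdivlMr// mulrC (le_trans (ltW h))//.
  exact: ler_norm.
apply: (@le_trans _ _ (C * x ^+ 2)).
  by rewrite gerBl !mulr_ge0// ?sqr_ge0// ltW.
apply: (@le_trans _ _ (`|C| * x ^+ 2)).
  by rewrite ler_wpM2r ?sqr_ge0// ler_norm.
by rewrite ler_wpM2l// lerXn2r// nnegrE// ltW.
Qed.

(** The correction [delta] such that [p = e^(- m^2 log m (1 + delta) / 2)]. *)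
Definition log_defect (p : R) (m : nat) : R :=
  - ln p / (2^-1 * m%:R ^+ 2 * ln m%:R) - 1.

Lemma log_defectP (p : R) m : 0 < p -> (2 <= m)%N ->
  p = expR (- (2^-1 * m%:R ^+ 2 * ln m%:R * (1 + log_defect p m))).
Proof.
move=> p0 m2; have m0 : 0 < m%:R :> R by rewrite ltr0n (leq_trans _ m2).
have l0 : 0 < ln m%:R :> R by rewrite ln_gt0// ltr1n.
rewrite /log_defect addrC subrK mulrC divfK ?opprK ?lnK//.
by rewrite gt_eqF// !mulr_gt0// exprn_gt0.
Qed.

(** The error [O(m^2)] divided by the main term [m^2 log m / 2]. *)
Lemma log_defect_le (p C C' : R) m : 0 < p -> (2 <= m)%N ->
  expR (- (2^-1 * m%:R ^+ 2 * ln m%:R) - C * m%:R ^+ 2) <= p ->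
  p <= expR (- (2^-1 * m%:R ^+ 2 * ln m%:R) + C' * m%:R ^+ 2) ->
  `|log_defect p m| <= 2 * (`|C| + `|C'|) / ln m%:R.
Proof.
move=> p0 m2; have m0 : 0 < m%:R :> R by rewrite ltr0n (leq_trans _ m2).
have l0 : 0 < ln m%:R :> R by rewrite ln_gt0// ltr1n.
rewrite -[X in _ <= X -> _](lnK p0) -[X in _ -> X <= _ -> _](lnK p0) !ler_expR.
have M0 : 0 < m%:R ^+ 2 :> R by rewrite exprn_gt0.
set M := m%:R ^+ 2 in M0 *; set l := ln m%:R in l0 *; set q := ln p.
have e0 : 0 < 2^-1 * M * l by rewrite !mulr_gt0.
move=> h1 h2.
have -> : 2 * (`|C| + `|C'|) / l = (`|C| + `|C'|) * M / (2^-1 * M * l).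
  by field; rewrite !gt_eqF.
have -> : log_defect p m = (- q - 2^-1 * M * l) / (2^-1 * M * l).
  by rewrite /log_defect -/M -/l -/q; field; rewrite !gt_eqF.
rewrite normrM normfV (gtr0_norm e0) ler_wpM2r ?invr_ge0 ?(ltW e0)//.
have c1 : C * M <= `|C| * M by rewrite ler_wpM2r ?(ltW M0)// ler_norm.
have c2 : C' * M <= `|C'| * M by rewrite ler_wpM2r ?(ltW M0)// ler_norm.
have c3 : 0 <= `|C| * M by rewrite mulr_ge0// ltW.
have c4 : 0 <= `|C'| * M by rewrite mulr_ge0// ltW.
by rewrite ler_norml; apply/andP; split; lra.
Qed.

Lemma cvg_inv_ln (D : R) (u : nat -> R) : 0 <= D ->
  (forall m, (2 <= m)%N -> `|u m| <= D / ln m%:R) -> u @ \oo --> (0 : R).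
Proof.
move=> D0 uD; apply/cvgrPdist_lt => e e0.
exists (Num.bound (expR (D / e))).+2 => // m /= hm.
have m2 : (2 <= m)%N by rewrite (leq_trans _ hm).
have m0 : 0 < m%:R :> R by rewrite ltr0n (leq_trans _ m2).
have l0 : 0 < ln m%:R :> R by rewrite ln_gt0// ltr1n.
rewrite sub0r normrN (le_lt_trans (uD m m2))// ltr_pdivrMr// mulrC -ltr_pdivrMr//.
rewrite -ltr_expR lnK// (lt_le_trans (archi_boundP (expR_ge0 _)))//.
by rewrite ler_nat (leq_trans _ hm)// -addn2 leq_addr.
Qed.

End asymptotics.

Unset Implicit Arguments.

Theorem theorem1 (R : realType) (d : measure_display) (T : measurableType d)
    (P : probability T R) (a : nat -> T -> Cplx R)
    (a_iid : iid_std_complex_normal P a) (r : R) (r_gt0 : 0 < r) :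
  let overcrowded (m : nat) : set T :=
    [set w | (m%:R%:E <= num_zeros (planar_gaf a w) r)%E] in
  [/\ (forall m : nat, measurable (overcrowded m)),
      (exists C1 : R, forall m : nat, (1 <= m)%N ->
        ((expR (- (2^-1 * m%:R ^+ 2 * ln m%:R) - C1 * m%:R ^+ 2))%:E
           <= P (overcrowded m))%E),
      (forall eps : R, 0 < eps -> exists C2 : R, forall m : nat, (1 <= m)%N ->
        (P (overcrowded m)
           <= (C2 * expR (- ((2^-1 - eps) * m%:R ^+ 2 * ln m%:R)))%:E)%E) &
      (exists2 delta : nat -> R, delta @ \oo --> (0 : R) &
        \forall m \near \oo, P (overcrowded m) =
          (expR (- (2^-1 * m%:R ^+ 2 * ln m%:R * (1 + delta m))))%:E)].
Proof.
move=> overcrowded.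
have mO m : measurable (overcrowded m).
  by apply: measurable_overcrowded => // n; exact: iid_mcplx a_iid n.
have [C1 lower] := overcrowding_lower_bound a_iid r_gt0.
have [C2 upper] := overcrowding_upper_bound a_iid r_gt0.
have PE m : P (overcrowded m) = (fine (P (overcrowded m)))%:E.
  by rewrite fineK// fin_num_measure.
split => //; first by exists C1.
  move=> eps e0; exists (expR (`|C2| * expR (`|C2| / eps) ^+ 2)) => m m1.
  apply: le_trans (upper m m1) _; rewrite lee_fin -expRD ler_expR.
  have m1R : 1 <= m%:R :> R by rewrite ler1n.
  by have := absorb_quadratic C2 e0 m1R; lra.
pose p m := fine (P (overcrowded m)).
have lowerp m : (1 <= m)%N ->
    expR (- (2^-1 * m%:R ^+ 2 * ln m%:R) - C1 * m%:R ^+ 2) <= p m.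
  by move=> m1; rewrite -lee_fin -PE; exact: lower.
have p0 m : (1 <= m)%N -> 0 < p m.
  by move=> m1; rewrite (lt_le_trans _ (lowerp m m1))// expR_gt0.
exists (fun m => log_defect (p m) m).
  apply: (@cvg_inv_ln _ (2 * (`|C1| + `|C2|))) => [|m m2].
    by rewrite mulr_ge0// addr_ge0.
  have m1 : (1 <= m)%N by rewrite (leq_trans _ m2).
  apply: log_defect_le => //; [exact: p0|exact: lowerp|].
  by rewrite -lee_fin -PE; exact: upper.
exists 2%N => // m /= m2; rewrite PE -/(p m).
by congr (_%:E); apply: log_defectP => //; apply: p0; rewrite (leq_trans _ m2).
Qed.
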